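(* Let $\Sigma$ be an oriented Riemann surface and let $X:\Sigma\to\mathrm{Nil}_3$ be a conformal minimal immersion that is nowhere vertical. Assume that its normal is upward. Then its Gauss map $g$ takes values in the hyperbolic disk $\mathbb{H}^2$, and $g:\Sigma\to\mathbb{H}^2$ is harmonic (for the hyperbolic metric).
   Context: The Heisenberg group $\mathrm{Nil}_3$ is $\mathbb{R}^3$ with coordinates $(x_1,x_2,x_3)$ and the Riemannian metric $$dx_1^2+dx_2^2+\left(\tfrac12(x_2\,dx_1-x_1\,dx_2)+dx_3\right)^2 .$$ The canonical left-invariant orthonormal frame is $E_1=\frac{\partial}{\partial x_1}-\frac{x_2}{2}\frac{\partial}{\partial x_3}$, $E_2=\frac{\partial}{\partial x_2}+\frac{x_1}{2}\frac{\partial}{\partial x_3}$, $E_3=\frac{\partial}{\partial x_3}$, and $\mathrm{Nil}_3$ is oriented so that this frame is positive. Tangent vectors are identified with elements of the Lie algebra by left multiplication, i.e. with their coordinates in the frame $(E_1,E_2,E_3)$. A surface is nowhere vertical if $E_3$ is nowhere tangent to it. For a conformal immersion $X:\Sigma\to\mathrm{Nil}_3$ of an oriented Riemann surface, with conformal coordinate $z=u+iv$, the unit normal $N$ is the normalization of $X_u\times X_v$, regarded as a map $N:\Sigma\to\mathbb{S}^2$ into the unit sphere of the Lie algebra. The normal is upward if the third component $\langle N,E_3\rangle$ is positive. The Gauss map of $X$ is the map $g:\Sigma\to\bar{\mathbb{C}}=\mathbb{C}\cup\{\infty\}$ obtained by stereographic projection of $N$ from the southern pole, i.e. in the frame $(E_1,E_2,E_3)$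 $$N=\frac{1}{1+|g|^2}\bigl(2\,\mathrm{Re}\,g,\;2\,\mathrm{Im}\,g,\;1-|g|^2\bigr).$$ The hyperbolic plane is the Poincaré disk $\mathbb{H}^2=\{z\in\mathbb{C}:|z|<1\}$ with the metric $\frac{4|dz|^2}{(1-|z|^2)^2}$. *)

(* Defs.v *)
From HB Require Import structures.
From mathcomp Require Import all_boot all_order all_algebra.
From mathcomp Require Import all_classical all_reals all_analysis.
From mathcomp Require Import complex ring lra.

Set Implicit Arguments.
Unset Strict Implicit.
Unset Printing Implicit Defensive.

Import Order.TTheory GRing.Theory Num.Theory.
Import numFieldNormedType.Exports.

Local Open Scope classical_set_scope.
Local Open Scope ring_scope.
Local Open Scope complex_scope.

(* The alias lets R[i] inherit, as a numFieldType, the topology given by the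
   modulus and the normed-module structure over itself. *)
Definition Cplx (R : realType) : numClosedFieldType := R[i].

Section RiemannSurfaces.
Context {R : realType}.

Definition holomorphic_on (U : set (Cplx R)) (f : Cplx R -> Cplx R) : Prop :=
  forall z, U z -> derivable f z 1.

Record chart (S : topologicalType) := Chart {
  cdom : set S;
  cimg : set (Cplx R);
  cmap : S -> Cplx R;
  cinv : Cplx R -> S;
  cdom_open : open cdom;
  cimg_open : open cimg;
  cmap_img : forall p, cdom p -> cimg (cmap p);
  cinv_dom : forall z, cimg z -> cdom (cinv z);
  cmapK : forall p, cdom p -> cinv (cmap p) = p;
  cinvK : forall z, cimg z -> cmap (cinv z) = z;
  cmap_continuous : forall p, cdom p -> {for p, continuous cmap};
  cinv_continuous : forall z, cimg z -> {for z, continuous cinv} }.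

End RiemannSurfaces.

(* Connectedness is not required.  The orientation is the one defined by the
   complex structure: (d/du, d/dv) is positive for every chart z = u + iv. *)
Record riemannSurface (R : realType) := RiemannSurface {
  carrier :> topologicalType;
  surf_hausdorff : hausdorff_space carrier;
  surf_second_countable : @second_countable carrier;
  atlas : set (@chart R carrier);
  chart_at : carrier -> @chart R carrier;
  chart_at_atlas : forall p, atlas (chart_at p);
  chart_at_dom : forall p, cdom (chart_at p) p;
  holomorphic_transition : forall c c', atlas c -> atlas c' ->
    holomorphic_on (cimg c `&` cinv c @^-1` cdom c') (cmap c' \o cinv c) }.

Section SmoothMaps.
Context {R : realType}.

Definition du : R * R := (1, 0).
Definition dv : R * R := (0, 1).

Fixpoint Ck_on (V : normedModType R) (k : nat) (U : set (R * R))
    (f : R * R -> V) : Prop :=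
  (forall w, U w -> {for w, continuous f}) /\
  (if k is k'.+1 then
     [/\ forall w, U w -> derivable f w du, forall w, U w -> derivable f w dv,
         Ck_on k' U ('D_du f) & Ck_on k' U ('D_dv f)]
   else True).

(* Expression of f in the coordinates (u, v) of the chart z = u + iv, and the
   open subset of R^2 on which it is meaningful. *)
Definition local_rep (S : topologicalType) (T : Type) (c : @chart R S)
    (f : S -> T) : R * R -> T :=
  fun w => f (cinv c (w.1 +i* w.2)).

Definition local_dom (S : topologicalType) (c : @chart R S) : set (R * R) :=
  [set w | cimg c (w.1 +i* w.2)].

Definition smooth (S : riemannSurface R) (n : nat) (f : S -> 'rV[R]_n) : Prop :=
  forall c, @atlas R S c -> forall k, Ck_on k (local_dom c) (local_rep c f).

End SmoothMaps.

Section RiemannianMetrics.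
Context {R : realType} {n : nat}.

(* A metric on (a part of) R^n is given by its Gram matrix in the standard
   coordinates; points and tangent vectors are row vectors. *)
Implicit Types (met : 'rV[R]_n -> 'M[R]_n) (x a b : 'rV[R]_n)
  (F : R * R -> 'rV[R]_n) (w s t : R * R).

Definition inner met x a b : R := (a *m met x *m b^T) 0 0.

Definition christoffel met x (k i j : 'I_n) : R :=
  let dmet (l p q : 'I_n) := 'D_(delta_mx 0 l) (fun y => met y p q) x in
  2^-1 * \sum_(l < n)
    invmx (met x) k l * (dmet i j l + dmet j i l - dmet l i j).

(* The covariant derivative in the direction s, along F, of the vector field
   given by the partial derivative of F in the direction t. *)
Definition nabla met F s t w : 'rV[R]_n :=
  'D_s ('D_t F) w +
  \row_k \sum_(i < n) \sum_(j < n)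
    christoffel met (F w) k i j * 'D_s F w 0 i * 'D_t F w 0 j.

(* Trace of the second fundamental form of the map F with respect to the flat
   metric du^2 + dv^2. *)
Definition tension met F w : 'rV[R]_n :=
  nabla met F du du w + nabla met F dv dv w.

(* Harmonicity of a map defined on a Riemann surface: in dimension 2 it only
   depends on the conformal class of the metric of the source, so that the flat
   metric of each conformal coordinate can be used. *)
Definition harmonic_map (S : riemannSurface R) met (f : S -> 'rV[R]_n) : Prop :=
  smooth f /\
  forall c, @atlas R S c -> forall w, local_dom c w ->
    tension met (local_rep c f) w = 0.

End RiemannianMetrics.

Section Nil3.
Context {R : realType}.

Definition row3 (a b c : R) : 'rV[R]_3 := \row_(i < 3) [:: a; b; c]`_i.

(* The 1-form (x_2 dx_1 - x_1 dx_2) / 2 + dx_3. *)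
Definition nil_form (x : 'rV[R]_3) : 'rV[R]_3 :=
  row3 (x 0 1 / 2) (- (x 0 0 / 2)) 1.

Definition nil_metric (x : 'rV[R]_3) : 'M[R]_3 :=
  diag_mx (row3 1 1 0) + (nil_form x)^T *m nil_form x.

Definition nil_E1 (x : 'rV[R]_3) : 'rV[R]_3 := row3 1 0 (- (x 0 1 / 2)).
Definition nil_E2 (x : 'rV[R]_3) : 'rV[R]_3 := row3 0 1 (x 0 0 / 2).
Definition nil_E3 (x : 'rV[R]_3) : 'rV[R]_3 := row3 0 0 1.

Definition nil_frame (x : 'rV[R]_3) : 'M[R]_3 :=
  \matrix_(i < 3) [:: nil_E1 x; nil_E2 x; nil_E3 x]`_i.

(* Identification of T_x Nil_3 with the Lie algebra: coordinates in the frame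
   (E1, E2, E3) of the tangent vector a at x. *)
Definition to_lie (x a : 'rV[R]_3) : 'rV[R]_3 := a *m invmx (nil_frame x).
Definition of_lie (x a : 'rV[R]_3) : 'rV[R]_3 := a *m nil_frame x.

Definition cross (a b : 'rV[R]_3) : 'rV[R]_3 :=
  row3 (a 0 1 * b 0 2 - a 0 2 * b 0 1)
       (a 0 2 * b 0 0 - a 0 0 * b 0 2)
       (a 0 0 * b 0 1 - a 0 1 * b 0 0).

(* The norm of the library on row vectors is the sup norm. *)
Definition enorm (a : 'rV[R]_3) : R := Num.sqrt ((a *m a^T) 0 0).

Definition normalize (a : 'rV[R]_3) : 'rV[R]_3 := (enorm a)^-1 *: a.

(* Unit normal, as an element of the Lie algebra, of a map F : R^2 -> Nil_3. *)
Definition local_normal (F : R * R -> 'rV[R]_3) (w : R * R) : 'rV[R]_3 :=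
  normalize (cross (to_lie (F w) ('D_du F w)) (to_lie (F w) ('D_dv F w))).

Definition second_form (F : R * R -> 'rV[R]_3) (s t w : R * R) : R :=
  inner nil_metric (F w) (nabla nil_metric F s t w)
    (of_lie (F w) (local_normal F w)).

Definition mean_curvature (F : R * R -> 'rV[R]_3) (w : R * R) : R :=
  let I s t := inner nil_metric (F w) ('D_s F w) ('D_t F w) in
  let II s t := second_form F s t w in
  (I du du * II dv dv - 2 * I du dv * II du dv + I dv dv * II du du) /
  (2 * (I du du * I dv dv - I du dv ^+ 2)).

Variable S : riemannSurface R.
Implicit Type X : S -> 'rV[R]_3.

Definition immersion X : Prop :=
  smooth X /\
  forall c, @atlas R S c -> forall w, local_dom c w ->
    let F := local_rep c X in \rank (col_mx ('D_du F w) ('D_dv F w)) = 2%N.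

Definition conformal X : Prop :=
  forall c, @atlas R S c -> forall w, local_dom c w ->
    let F := local_rep c X in
    let I s t := inner nil_metric (F w) ('D_s F w) ('D_t F w) in
    I du du = I dv dv /\ I du dv = 0.

Definition minimal X : Prop :=
  forall c, @atlas R S c -> forall w, local_dom c w ->
    mean_curvature (local_rep c X) w = 0.

Definition nowhere_vertical X : Prop :=
  forall c, @atlas R S c -> forall w, local_dom c w ->
    let F := local_rep c X in
    ~~ (nil_E3 (F w) <= col_mx ('D_du F w) ('D_dv F w))%MS.

Definition unit_normal X (p : S) : 'rV[R]_3 :=
  let c := chart_at p in
  let z := cmap c p in
  local_normal (local_rep c X) (complex.Re z, complex.Im z).

Definition upward X : Prop := forall p, 0 < unit_normal X p 0 2.

End Nil3.

Section GaussMap.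
Context {R : realType}.

(* The extended plane C u {oo} is option (Cplx R), with oo = None. *)
Definition stereographic (N : 'rV[R]_3) : option (Cplx R) :=
  if 1 + N 0 2 == 0 then None
  else Some ((N 0 0 / (1 + N 0 2)) +i* (N 0 1 / (1 + N 0 2))).

Definition inv_stereographic (g : option (Cplx R)) : 'rV[R]_3 :=
  if g is Some (a +i* b) then
    (1 + (a ^+ 2 + b ^+ 2))^-1 *: row3 (2 * a) (2 * b) (1 - (a ^+ 2 + b ^+ 2))
  else row3 0 0 (- 1).

Definition gauss_map (S : riemannSurface R) (X : S -> 'rV[R]_3) (p : S) :
  option (Cplx R) := stereographic (unit_normal X p).

Definition poincare_disk : set (Cplx R) := [set z | `|z| < 1].

Definition plane_coord (z : Cplx R) : 'rV[R]_2 :=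
  \row_(i < 2) [:: complex.Re z; complex.Im z]`_i.

(* 4 |dz|^2 / (1 - |z|^2)^2 *)
Definition hyperbolic_metric (x : 'rV[R]_2) : 'M[R]_2 :=
  (4 / (1 - (x 0 0 ^+ 2 + x 0 1 ^+ 2)) ^+ 2)%:M.

End GaussMap.

Section Checks.
Context {R : realType}.

Lemma nil_frame_orthonormal (x : 'rV[R]_3) :
  nil_frame x *m nil_metric x *m (nil_frame x)^T = 1%:M.
Proof.
apply/matrixP => i j.
rewrite !mxE !big_ord_recl !big_ord0 /= !mxE !big_ord_recl !big_ord0 /=.
rewrite !mxE !big_ord_recl !big_ord0 /= !mxE.
by case: i => [[|[|[|//]]] ?]; case: j => [[|[|[|//]]] ?];
  rewrite /= !mxE /= ?mulr1n ?mulr0n; field.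
Qed.

Lemma stereographicK (N : 'rV[R]_3) : enorm N = 1 ->
  inv_stereographic (stereographic N) = N.
Proof.
move=> N1; have h : N 0 0 ^+ 2 + N 0 1 ^+ 2 + N 0 2 ^+ 2 = 1.
  have NN : (N *m N^T) 0 0 = N 0 0 ^+ 2 + N 0 1 ^+ 2 + N 0 2 ^+ 2.
    rewrite !mxE !big_ord_recl big_ord0 !mxE addr0 addrA !expr2.
    by congr (_ * _ + _ * _ + _ * _); congr (N _ _); apply/val_inj.
  rewrite -NN -[LHS]sqr_sqrtr -/(enorm N) ?N1 ?expr1n// NN.
  by rewrite !addr_ge0 ?sqr_ge0.
move: h => {N1}.
have -> : N = row3 (N 0 0) (N 0 1) (N 0 2).
  apply/rowP => i; rewrite mxE; case: i => [[|[|[|//]]] ?] /=;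
  by congr (N _ _); apply/val_inj.
move: (N 0 0) (N 0 1) (N 0 2) => a b c; rewrite /stereographic !mxE /= => h.
case: ifPn => [/eqP c1|c1].
  have ab : a ^+ 2 + b ^+ 2 = 0 by nra.
  move: (ab) => /eqP; rewrite paddr_eq0 ?sqr_ge0// !sqrf_eq0.
  move=> /andP[/eqP-> /eqP->] /=; congr row3; lra.
have e : (a / (1 + c)) ^+ 2 + (b / (1 + c)) ^+ 2 = (1 - c) / (1 + c).
  have -> : (a / (1 + c)) ^+ 2 + (b / (1 + c)) ^+ 2
            = (a ^+ 2 + b ^+ 2) / (1 + c) ^+ 2 by field.
  have -> : a ^+ 2 + b ^+ 2 = (1 - c) * (1 + c) by lra.
  by field.
have -> : inv_stereographic (Some ((a / (1 + c)) +i* (b / (1 + c)))) =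
  (1 + (1 - c) / (1 + c))^-1 *:
    row3 (2 * (a / (1 + c))) (2 * (b / (1 + c))) (1 - (1 - c) / (1 + c)).
  by rewrite -e.
have d : 1 + (1 - c) / (1 + c) = 2 / (1 + c) by field.
rewrite d; apply/rowP => i; rewrite !mxE.
by case: i => [[|[|[|//]]] ?] /=; field.
Qed.

End Checks.

(* Main.v *)
From HB Require Import structures.
Require Import Defs.
From mathcomp Require Import all_boot all_order all_algebra.
From mathcomp Require Import all_classical all_reals all_analysis.
From mathcomp Require Import complex ring lra.

Set Implicit Arguments.
Unset Strict Implicit.
Unset Printing Implicit Defensive.

Import Order.TTheory GRing.Theory Num.Theory.
Import numFieldNormedType.Exports.

Local Open Scope classical_set_scope.
Local Open Scope ring_scope.

(** Write the derivatives of a conformal immersion X = F(u, v), read in the Lie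
    algebra, as a = X^-1 X_u and b = X^-1 X_v.  Conformality makes a, b
    orthogonal of equal length, so the isotropic vector (a - i b) / 2 has a
    Weierstrass representation: it is determined by the stereographic projection
    g of the normal and by p = (P + i Q) / 2, where P = a1 + b2 and
    Q = a2 - b1 ([weierstrass_representation]).  An upward normal says that
    a1 b2 - a2 b1 > 0, equivalently that p does not vanish and |g| < 1.

    Two systems of first order equations hold for (a, b).  Equality of mixed
    partials of X gives the structure equations of the group, where the only
    nonzero bracket is [E1, E2] = E3 ([lie3_structure]).  Minimality gives the
    three components of the vanishing of the tension field of X: its normal
    component is the mean curvature, and its tangential components vanish for
    every conformal map ([tension_components]).  Together they amount to
        p_zbar = - (i / 2) g (1 - |g|^2) |p|^2    and
        g_z = (i / 4) (1 - |g|^2)^2 p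
    ([frame_dbar], [gauss_first_order]).  Differentiating the second equation
    with respect to zbar and eliminating p with the first one yields
        g_(z zbar) + 2 conj(g) g_z g_zbar / (1 - |g|^2) = 0,
    the equation of harmonic maps into the Poincare disk
    ([harmonic_identity], [gauss_harmonic]).  In the file everything is written
    with the real derivatives along u and v.

    The normal at a point is defined with one particular chart around it.  A
    holomorphic change of coordinates multiplies X_u x X_v by the positive
    factor |tau'|^2, so that every chart gives the same normal
    ([local_normal_chart]); this needs the Cauchy-Riemann equations and the
    chain rule for C^1 functions of two variables.  Smoothness of g follows
    from its expression as a rational function of a and b whose denominator
    P^2 + Q^2 has no zero. *)

(** * Calculus in the plane *)

Lemma differentiable_approx (K : numFieldType) (V W : normedModType K)
    (f : V -> W) (df : {linear V -> W}) (x : V) :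
  continuous df ->
  (forall e : K, 0 < e ->
     \forall h \near (0 : V), `|f (h + x) - (f x + df h)| <= e * `|h|) ->
  differentiable f x /\ 'd f x = df :> (V -> W).
Proof.
move=> cdf Hdf.
have o_df : f \o shift x = cst (f x) + df +o_ 0 id.
  by apply/eqaddoP => e e0; exact: Hdf.
have dfE : 'd f x = df :> (V -> W) by exact: diff_unique.
by split=> //; apply/diff_locallyP; rewrite dfE.
Qed.

Section PlaneCalculus.
Context {R : realType}.
Implicit Types (f g : R * R -> R) (w s : R * R) (U : set (R * R)).

(** The declared codomain R, instead of the carrier of a normed module over R,
    lets the ring operations on values of [pd] be those of R itself. *)
Definition pd s f : R * R -> R := 'D_s f.

Lemma is_derive_line f w s (t : R) : derivable f (w + t *: s) s ->
  is_derive t 1 (fun r : R => f (w + r *: s)) (pd s f (w + t *: s)).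
Proof.
move=> df.
suff E : (fun h : R => h^-1 *:
    (((fun r : R => f (w + r *: s)) \o shift t) (h *: 1) - f (w + t *: s)))
  = (fun h => h^-1 *: ((f \o shift (w + t *: s)) (h *: s) - f (w + t *: s))).
  by apply: DeriveDef; rewrite /pd /derivable /derive E.
apply/funext => h /=; congr (_ *: (f _ - _)).
by rewrite scaler1 scalerDl addrCA.
Qed.

(** The parameter h may be negative; this spares a case analysis on signs
    wherever increments are estimated. *)
Lemma MVT_line f w s (h : R) :
  (forall t : R, `|t| <= `|h| -> derivable f (w + t *: s) s) ->
  exists2 t : R, `|t| <= `|h| & f (w + h *: s) - f w = h * pd s f (w + t *: s).
Proof.
move=> df.
pose F (t : R) := f (w + t *: s).
have dF (t : R) : `|t| <= `|h| -> is_derive t 1 F (pd s f (w + t *: s)).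
  by move=> /df; exact: is_derive_line.
have cF (a b : R) : (forall t : R, t \in `[a, b] -> `|t| <= `|h|) ->
    {within `[a, b], continuous F}.
  move=> ab; apply: derivable_within_continuous => t /ab /dF dFt.
  exact: ex_derive.
have F0 : F 0 = f w by rewrite /F scale0r addr0.
have [h0|h0] := leP 0 h.
- have [||t] := MVT_segment (f := F) (df := fun t => pd s f (w + t *: s)) h0.
  + move=> t; rewrite in_itv/= => /andP[t0 th]; apply: dF.
    by rewrite !ger0_norm// ltW.
  + apply: cF => t; rewrite in_itv/= => /andP[t0 th].
    by rewrite !ger0_norm.
  rewrite in_itv/= => /andP[t0 th]; rewrite F0 subr0 mulrC => E; exists t => //.
  by rewrite !ger0_norm.
- have [||t] := MVT_segment (f := F) (df := fun t => pd s f (w + t *: s)) (ltW h0).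
  + move=> t; rewrite in_itv/= => /andP[t0 th]; apply: dF.
    by rewrite !ltr0_norm// lerN2 ltW.
  + apply: cF => t; rewrite in_itv/= => /andP[t0 th].
    by rewrite (ltr0_norm h0) ler0_norm// lerN2.
  rewrite in_itv/= => /andP[t0 th]; rewrite F0 sub0r => E; exists t => //.
    by rewrite (ltr0_norm h0) ler0_norm// lerN2.
  by apply: oppr_inj; rewrite opprB E mulrN mulrC.
Qed.

(** Neighbourhoods in the form used to estimate increments along a horizontal
    segment followed by a vertical one. *)
Lemma near_box w (A : set (R * R)) : (\forall z \near w, A z) ->
  exists2 e : R, 0 < e & forall x y : R, `|x| <= e -> `|y| <= e ->
    A (w + x *: du + y *: dv).
Proof.
move=> /nbhs_ballP[e /= e0 eA]; exists (e / 2); first by rewrite divr_gt0.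
move=> x y xe ye; apply: eA; rewrite -ball_normE /ball_/=.
rewrite /du /dv -addrA opprD addrA subrr add0r normrN.
have -> : x *: (1, 0) + y *: (0, 1) = (x, y) :> R * R.
  by congr pair; rewrite /= ?scaler1 ?scaler0 ?addr0 ?add0r.
rewrite prod_normE/= gt_max; apply/andP.
by split; rewrite ?(le_lt_trans xe) ?(le_lt_trans ye)// gtr_pMr// invf_lt1// ltr1n.
Qed.

Lemma increment_bound (x y A A0 B B0 e : R) :
  `|A - A0| <= e / 2 -> `|B - B0| <= e / 2 ->
  `|y * A + x * B - (x * B0 + y * A0)| <= e * Num.max `|x| `|y|.
Proof.
move=> HA HB.
have -> : y * A + x * B - (x * B0 + y * A0) = y * (A - A0) + x * (B - B0).
  by ring.
rewrite (le_trans (ler_normD _ _))// !normrM (splitr e) mulrDl.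
by apply: lerD; rewrite mulrC ler_pM// le_max lexx ?orbT.
Qed.

(** The increment of f is split into a vertical and a horizontal one; the mean
    value theorem turns each into a partial derivative at a nearby point, which
    continuity compares with the partial derivative at w. *)
Lemma C1_differentiable U f w : open U -> U w -> Ck_on 1 U f ->
  differentiable f w /\
  forall h, 'd f w h = h.1 * pd du f w + h.2 * pd dv f w.
Proof.
move=> oU Uw [_ [dfu dfv [cu _] [cv _]]].
pose df (h : R * R) := h.1 * pd du f w + h.2 * pd dv f w.
have lin_df : linear df.
  by move=> k [x1 x2] [y1 y2]; rewrite /df /= !mulrDl -!scalerAl scalerDr addrACA.
pose dfM := GRing.isLinear.Build _ _ _ _ _ lin_df.
pose dfL : {linear _ -> _} := HB.pack df dfM.
have cdf : continuous (dfL : R * R -> R).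
  move=> h; rewrite /= /df; apply: cvgD; apply: cvgM; try exact: cvg_cst.
  - exact: cvg_fst.
  - exact: cvg_snd.
have Hdf (e : R) : 0 < e ->
    \forall h \near (0 : R * R), `|f (h + w) - (f w + dfL h)| <= e * `|h|.
  move=> e0.
  have [] := @near_box w (fun z => [/\ U z, `|pd du f z - pd du f w| < e / 2
     & `|pd dv f z - pd dv f w| < e / 2]).
    have e20 : 0 < e / 2 by rewrite divr_gt0.
    have /cvgrPdist_lt/(_ _ e20) h1 := cu w Uw.
    have /cvgrPdist_lt/(_ _ e20) h2 := cv w Uw.
    have UU : nbhs w U by exact: open_nbhs_nbhs.
    apply: filterS3 UU h1 h2 => z Uz h1 h2.
    by split; [exact: Uz | rewrite distrC; exact: h1 | rewrite distrC; exact: h2].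
  move=> d d0 H.
  suff Hxy (x y : R) : `|x| <= d -> `|y| <= d ->
      `|f ((x, y) + w) - (f w + dfL (x, y))| <= e * `|(x, y)|.
    near=> h; have hd : `|h| < d by near: h; apply: cvgr0_norm_lt => //; exact: cvg_id.
    rewrite (surjective_pairing h); apply: Hxy; apply/ltW/(le_lt_trans _ hd).
      by rewrite prod_normE/= le_max lexx.
    by rewrite prod_normE/= le_max lexx orbT.
  move=> xd yd.
  have [t ty Et] : exists2 t : R, `|t| <= `|y| &
     f (w + x *: du + y *: dv) - f (w + x *: du) = y * pd dv f (w + x *: du + t *: dv).
    apply: MVT_line => r ry; apply: dfv.
    by have [] := H x r xd (le_trans ry yd).
  have [r rx Er] : exists2 t : R, `|t| <= `|x| &
     f (w + x *: du) - f w = x * pd du f (w + t *: du).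
    apply: MVT_line => q qx; apply: dfu.
    by have [] := H q 0 (le_trans qx xd); rewrite ?normr0 ?ltW// scale0r addr0.
  have -> : (x, y) + w = w + x *: du + y *: dv.
    rewrite addrC -addrA; congr (_ + _); rewrite /du /dv.
    by congr pair; rewrite /= ?scaler1 ?scaler0 ?addr0 ?add0r.
  rewrite [X in `|X|](_ : _ = (f (w + x *: du + y *: dv) - f (w + x *: du)) +
      (f (w + x *: du) - f w) - df (x, y)); last first.
    by rewrite -[dfL _]/(df _); ring.
  have [_ _ /ltW Ht] := H x t xd (le_trans ty yd).
  have [_ /ltW Hr _] : [/\ U (w + r *: du),  `|pd du f (w + r *: du) - pd du f w| < e / 2
     & `|pd dv f (w + r *: du) - pd dv f w| < e / 2].
    by have := H r 0 (le_trans rx xd); rewrite scale0r addr0; apply; rewrite normr0 ltW.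
  rewrite Et Er [in leRHS]prod_normE /=; exact: increment_bound Ht Hr.
have [dfw dfE] := differentiable_approx cdf Hdf.
by split => // h; rewrite dfE.
Unshelve. all: by end_near. Qed.

End PlaneCalculus.

Section Smooth.
Context {R : realType}.
Implicit Types (f g : R * R -> R) (w s t : R * R) (U : set (R * R)) (k : nat).

Lemma pd_shift f w s t : derivable f (w + t) s ->
  derivable (fun z => f (z + t)) w s /\
  pd s (fun z => f (z + t)) w = pd s f (w + t).
Proof.
suff E : (fun h : R => h^-1 *: (((fun z => f (z + t)) \o shift w) (h *: s) - f (w + t)))
  = (fun h => h^-1 *: ((f \o shift (w + t)) (h *: s) - f (w + t))).
  by rewrite /derivable /pd /derive E.
by apply/funext => h /=; rewrite addrA.
Qed.

(** The mean value theorem along s, applied to z |-> f (z + h t) - f z, then along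
    t, applied to the derivative of f along s. *)
Lemma second_difference f w s t (h : R) :
  (forall x y : R, `|x| <= `|h| -> `|y| <= `|h| ->
     derivable f (w + x *: s + y *: t) s /\
     derivable (pd s f) (w + x *: s + y *: t) t) ->
  exists x y : R, [/\ `|x| <= `|h|, `|y| <= `|h| &
    f (w + h *: s + h *: t) - f (w + h *: s) - (f (w + h *: t) - f w) =
    h * (h * pd t (pd s f) (w + x *: s + y *: t))].
Proof.
move=> df.
pose F z := f (z + h *: t) - f z.
have dF (x : R) : `|x| <= `|h| -> derivable F (w + x *: s) s /\
    pd s F (w + x *: s) = pd s f (w + x *: s + h *: t) - pd s f (w + x *: s).
  move=> xh; have [d1 _] := df x h xh (lexx _).
  have [d2 _] : derivable f (w + x *: s) s /\ derivable (pd s f) (w + x *: s) t.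
    by have := df x 0 xh; rewrite scale0r addr0; apply; rewrite normr0.
  have [d3 E3] := pd_shift d1.
  by split; [exact: derivableB|rewrite -E3 /pd; exact: deriveB].
have [x xh Ex] := @MVT_line _ F w s h (fun x xh => (dF x xh).1).
have [y yh Ey] := @MVT_line _ (pd s f) (w + x *: s) t h
  (fun y yh => (df x y xh yh).2).
exists x, y; split => //.
rewrite -Ey -(dF x xh).2 -Ex /F; congr (_ - (f _ - _)).
Qed.

(** The second difference over a small square is symmetric in the two directions,
    and divided by the area it is a value of either mixed derivative near w. *)
Lemma mixed_partials U f w : open U -> U w -> Ck_on 2 U f ->
  pd dv (pd du f) w = pd du (pd dv f) w.
Proof.
move=> oU Uw [_ [dfu dfv [_ [_ dfuv _ [cuv _]]] [_ [dfvu _ [cvu _] _]]]].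
apply/eqP; rewrite -subr_eq0 -normr_le0; apply/ler_addgt0Pr => e e0; rewrite add0r.
have [] := @near_box _ w (fun z => [/\ U z,
     `|pd dv (pd du f) w - pd dv (pd du f) z| < e / 2
   & `|pd du (pd dv f) w - pd du (pd dv f) z| < e / 2]).
  have e20 : 0 < e / 2 by rewrite divr_gt0.
  have /cvgrPdist_lt/(_ _ e20) h1 := cuv w Uw.
  have /cvgrPdist_lt/(_ _ e20) h2 := cvu w Uw.
  have UU : nbhs w U by exact: open_nbhs_nbhs.
  by apply: filterS3 UU h1 h2 => z Uz g1 g2; split; [exact: Uz|exact: g1|exact: g2].
move=> h h0 H.
have hh : `|h| = h by rewrite gtr0_norm.
have [|x [y [xh yh E1]]] := @second_difference f w du dv h.
  move=> x y; rewrite hh => xh yh; have [Uz _ _] := H x y xh yh.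
  by split; [exact: dfu|exact: dfuv].
have [|x' [y' [xh' yh' E2]]] := @second_difference f w dv du h.
  move=> x' y'; rewrite hh addrAC => xh' yh'; have [Uz _ _] := H y' x' yh' xh'.
  by split; [exact: dfv|exact: dfvu].
rewrite (addrAC w (x' *: dv)) (addrAC w (h *: dv)) in E2.
move: xh yh xh' yh'; rewrite hh => xh yh xh' yh'.
have [_ h1 _] := H _ _ xh yh.
have [_ _ h2] := H _ _ yh' xh'.
(* both second differences are the same number, and h^2 is nonzero *)
have E : pd dv (pd du f) (w + x *: du + y *: dv) =
    pd du (pd dv f) (w + y' *: du + x' *: dv).
  apply: (mulfI (lt0r_neq0 h0)); apply: (mulfI (lt0r_neq0 h0)).
  apply: etrans (esym E1) (etrans _ E2).
  move: (f _) (f _) (f _) (f _) => a b c d; ring.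
rewrite E in h1.
move: h1 h2; set c := pd _ _ (w + _ + _); set a := pd _ _ w; set b := pd _ _ w.
move: a b c => a b c h1 h2.
rewrite -(subrKA c) (splitr e).
apply: le_trans (ler_normD _ _) (lerD (ltW h1) _).
rewrite distrC; exact: ltW h2.
Qed.

Lemma pd_line f w s : 'D_1 (fun h : R => f (h *: s + w)) 0 = pd s f w.
Proof.
rewrite /pd /derive; set g1 := fun h => h^-1 *: _; set g2 := fun h => h^-1 *: _.
suff -> : g1 = g2 by [].
by rewrite funeqE /g1 /g2 => h /=; rewrite addr0 scale0r add0r [_%:A]mulr1.
Qed.

(** Chain rule, reduced to curves: along the line h |-> h s + w the inner map is a
    differentiable curve, and f is differentiable because it is C^1. *)
Lemma pd_comp U f (phi psi : R * R -> R) w s :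
  open U -> U (phi w, psi w) -> Ck_on 1 U f ->
  derivable phi w s -> derivable psi w s ->
  derivable (fun z => f (phi z, psi z)) w s /\
  pd s (fun z => f (phi z, psi z)) w =
    pd du f (phi w, psi w) * pd s phi w + pd dv f (phi w, psi w) * pd s psi w.
Proof.
move=> oU Uw Cf dphi dpsi.
have [df dfE] := C1_differentiable oU Uw Cf.
have lin (g : R * R -> R) : derivable g w s ->
    differentiable (fun h : R => g (h *: s + w)) 0 /\
    'd (fun h : R => g (h *: s + w)) 0 1 = pd s g w.
  move=> dg; have dl : derivable (fun h : R => g (h *: s + w)) 0 1.
    by have /derivable1P := dg.
  have dd := (derivable1_diffP _ _).1 dl; split; first exact: dd.
  by rewrite -(deriveE _ dd) pd_line.
have [d1 E1] := lin _ dphi.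
have [d2 E2] := lin _ dpsi.
have dp := differentiable_pair d1 d2.
have df0 : differentiable f (phi (0 *: s + w), psi (0 *: s + w)).
  by rewrite scale0r add0r.
have dc := differentiable_comp dp df0.
split.
  apply: (derivable1P (fun z => f (phi z, psi z)) w s).2.
  by apply: diff_derivable; exact: dc.
transitivity ('d (f \o (fun h : R => (phi (h *: s + w), psi (h *: s + w)))) 0 1).
  by rewrite -(deriveE _ dc) -pd_line.
rewrite (diff_comp dp df0) /comp (diff_pair d1 d2) scale0r add0r dfE.
cbn [fst snd]; rewrite E1 E2.
by rewrite mulrC [X in _ + X]mulrC.
Qed.

End Smooth.

(** * Algebra of functions of class C^k *)

Section CkAlgebra.
Context {R : realType}.
Implicit Types (f g : R * R -> R) (w s : R * R) (U : set (R * R)) (k : nat).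

Lemma Ck_on_pred (V : normedModType R) k U (F : R * R -> V) :
  Ck_on k.+1 U F -> Ck_on k U F.
Proof.
elim: k F => [|k IH] F; first by case.
move=> [cF [d1 d2 C1 C2]]; split; first exact: cF.
by split; [exact: d1|exact: d2|exact: IH C1|exact: IH C2].
Qed.

(** Derivatives are taken of total functions, whose values outside of U are
    meaningless; openness of U makes them depend on the restrictions to U only. *)
Lemma Ck_on_eq (V : normedModType R) k U (F G : R * R -> V) :
  open U -> (forall w, U w -> F w = G w) -> Ck_on k U F -> Ck_on k U G.
Proof.
move=> oU; have nU w : U w -> \forall z \near w, U z by move=> ?; exact: open_nbhs_nbhs.
elim: k F G => [|k IH] F G FG [cF dF].
all: have nFG w : U w -> \forall z \near w, F z = G z
  by move=> Uw; apply: filterS (nU w Uw) => z; exact: FG.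
all: have cG w : U w -> {for w, continuous G}.
1,3: move=> Uw; rewrite /prop_for /continuous_at -(FG w Uw);
  exact: cvg_trans (near_eq_cvg (nFG w Uw)) (cF w Uw).
- by split; [exact: cG|].
- case: dF => d1 d2 C1 C2; split; [exact: cG|split].
  + by move=> w Uw; exact: near_eq_derivable (nFG w Uw) (d1 w Uw).
  + by move=> w Uw; exact: near_eq_derivable (nFG w Uw) (d2 w Uw).
  + by apply: IH C1 => w Uw; exact: near_eq_derive (nFG w Uw).
  + by apply: IH C2 => w Uw; exact: near_eq_derive (nFG w Uw).
Qed.

Lemma Ck_on_pd k U f : Ck_on k.+1 U f -> Ck_on k U (pd du f) /\ Ck_on k U (pd dv f).
Proof. by move=> [_ [_ _ C1 C2]]; split; [exact: C1|exact: C2]. Qed.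

Lemma Ck_on_derivable k U f : Ck_on k.+1 U f ->
  forall w, U w -> derivable f w du /\ derivable f w dv.
Proof. by move=> [_ [d1 d2 _ _]] w Uw; split; [exact: d1|exact: d2]. Qed.

Lemma Ck_on_cst (c : R) k U : Ck_on k U (fun=> c).
Proof.
elim: k c => [|k IH] c; (split; first by move=> w _; exact: cvg_cst).
  exact: I.
have D0 s : 'D_s (fun=> c) = (fun=> 0) :> (R * R -> R).
  by apply/funext => w; exact: derive_cst.
split; rewrite ?D0; [move=> w _|move=> w _|exact: IH|exact: IH];
  exact: derivable_cst.
Qed.

Lemma pdD f g w s : derivable f w s -> derivable g w s ->
  pd s (fun z => f z + g z) w = pd s f w + pd s g w.
Proof. exact: deriveD. Qed.

Lemma pdM f g w s : derivable f w s -> derivable g w s ->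
  pd s (fun z => f z * g z) w = f w * pd s g w + g w * pd s f w.
Proof. exact: deriveM. Qed.

Lemma pdV f w s : f w != 0 -> derivable f w s ->
  pd s (fun z => (f z)^-1) w = - ((f w)^-1 * (f w)^-1) * pd s f w.
Proof.
by move=> f0 df; rewrite /pd (deriveV f0 df) expr2 invfM.
Qed.

Lemma Ck_onD k U f g : open U -> Ck_on k U f -> Ck_on k U g ->
  Ck_on k U (fun w => f w + g w).
Proof.
move=> oU; elim: k f g => [|k IH] f g [cf df] [cg dg].
  by split; [move=> w Uw|]; last exact: I; apply: cvgD; [exact: cf|exact: cg].
split; first by move=> w Uw; apply: cvgD; [exact: cf|exact: cg].
case: df dg => [d1 d2 C1 C2] [e1 e2 D1 D2]; split.
- by move=> w Uw; apply: derivableD; [exact: d1|exact: e1].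
- by move=> w Uw; apply: derivableD; [exact: d2|exact: e2].
- apply: (Ck_on_eq oU _ (IH _ _ C1 D1)) => w Uw; apply/esym.
  by apply: pdD; [exact: d1|exact: e1].
- apply: (Ck_on_eq oU _ (IH _ _ C2 D2)) => w Uw; apply/esym.
  by apply: pdD; [exact: d2|exact: e2].
Qed.

Lemma Ck_onM k U f g : open U -> Ck_on k U f -> Ck_on k U g ->
  Ck_on k U (fun w => f w * g w).
Proof.
move=> oU; elim: k f g => [|k IH] f g Cf Cg.
  by split; [move=> w Uw|]; last exact: I; apply: cvgM; [exact: Cf.1|exact: Cg.1].
have [f' g'] := (Ck_on_pred Cf, Ck_on_pred Cg).
case: Cf Cg => cf [d1 d2 C1 C2] [cg [e1 e2 D1 D2]].
split; first by move=> w Uw; apply: cvgM; [exact: cf|exact: cg].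
split.
- by move=> w Uw; apply: derivableM; [exact: d1|exact: e1].
- by move=> w Uw; apply: derivableM; [exact: d2|exact: e2].
- apply: (Ck_on_eq oU _ (Ck_onD oU (IH _ _ f' D1) (IH _ _ g' C1))) => w Uw.
  by apply/esym/pdM; [exact: d1|exact: e1].
- apply: (Ck_on_eq oU _ (Ck_onD oU (IH _ _ f' D2) (IH _ _ g' C2))) => w Uw.
  by apply/esym/pdM; [exact: d2|exact: e2].
Qed.

Lemma Ck_onN k U f : open U -> Ck_on k U f -> Ck_on k U (fun w => - f w).
Proof.
move=> oU Cf; apply: (Ck_on_eq oU _ (Ck_onM oU (Ck_on_cst (-1) k U) Cf)) => w _.
by rewrite mulN1r.
Qed.

Lemma Ck_onV k U f : open U -> (forall w, U w -> f w != 0) -> Ck_on k U f ->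
  Ck_on k U (fun w => (f w)^-1).
Proof.
move=> oU f0; elim: k => [|k IH] Cf.
  by split; [move=> w Uw|]; last exact: I; apply: cvgV; [exact: f0|exact: Cf.1].
have CV := IH (Ck_on_pred Cf).
case: Cf => cf [d1 d2 C1 C2].
split; first by move=> w Uw; apply: cvgV; [exact: f0|exact: cf].
have CVV := Ck_onN oU (Ck_onM oU CV CV).
split.
- by move=> w Uw; apply: derivableV; [exact: f0|exact: d1].
- by move=> w Uw; apply: derivableV; [exact: f0|exact: d2].
- apply: (Ck_on_eq oU _ (Ck_onM oU CVV C1)) => w Uw.
  by apply/esym/pdV; [exact: f0|exact: d1].
- apply: (Ck_on_eq oU _ (Ck_onM oU CVV C2)) => w Uw.
  by apply/esym/pdV; [exact: f0|exact: d2].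
Qed.

Lemma derive_coord n (F : R * R -> 'rV[R]_n) (i : 'I_n) w s :
  derivable F w s -> ('D_s F w) 0 i = pd s (fun z => F z 0 i) w.
Proof. by move=> dF; rewrite derive_mx// mxE. Qed.

Lemma continuous_coordP n (F : R * R -> 'rV[R]_n) w :
  {for w, continuous F} <-> forall i, {for w, continuous (fun z => F z 0 i)}.
Proof.
split=> [cF i|cF].
  have := @continuous_comp _ _ _ F (fun M : 'rV[R]_n => M 0 i) w cF.
  by apply; exact: coord_continuous.
have /(_ _)/cvgrPdist_lt cFi := cF _.
apply/cvgrPdist_lt => e e0.
have HF : \forall z \near w, forall i, `|F w 0 i - F z 0 i| < e.
  apply: (@filter_forall _ _ (fun i z => `|F w 0 i - F z 0 i| < e) (nbhs w) _).
  by move=> i; exact: cFi e0.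
apply: filterS HF => z Hz; rewrite [ltLHS]/Num.Def.normr/= mx_normrE.
by apply/bigmax_ltP; split => // -[j i] _ /=; rewrite ord1 !mxE.
Qed.

Lemma Ck_on_coord n k U (F : R * R -> 'rV[R]_n) : open U ->
  Ck_on k U F <-> forall i, Ck_on k U (fun w => F w 0 i).
Proof.
move=> oU; split.
- move=> CF i; elim: k F CF => [|k IH] F [cF dF].
    by split; [move=> w Uw; exact: (continuous_coordP _ _).1 (cF w Uw) i|].
  case: dF => d1 d2 C1 C2; split.
    by move=> w Uw; exact: (continuous_coordP _ _).1 (cF w Uw) i.
  split.
  + by move=> w Uw; move: (d1 w Uw) => /derivable_mxP; exact.
  + by move=> w Uw; move: (d2 w Uw) => /derivable_mxP; exact.
  + by apply: (Ck_on_eq oU _ (IH _ C1)) => w Uw; apply/derive_coord/d1.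
  + by apply: (Ck_on_eq oU _ (IH _ C2)) => w Uw; apply/derive_coord/d2.
- elim: k F => [|k IH] F CF.
    by split; [move=> w Uw; apply/continuous_coordP => i; exact: (CF i).1|].
  have d s : (s = du \/ s = dv) -> forall w, U w -> derivable F w s.
    move=> Hs w Uw; apply/derivable_mxP => j i; rewrite ord1.
    by have [h1 h2] := Ck_on_derivable (CF i) Uw; case: Hs => ->; [exact: h1|exact: h2].
  split; first by move=> w Uw; apply/continuous_coordP => i; exact: (CF i).1.
  split; [by apply: d; left|by apply: d; right| |].
  + apply: IH => i; apply: (Ck_on_eq oU _ (Ck_on_pd (CF i)).1) => w Uw.
    by apply/esym/derive_coord/d => //; left.
  + apply: IH => i; apply: (Ck_on_eq oU _ (Ck_on_pd (CF i)).2) => w Uw.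
    by apply/esym/derive_coord/d => //; right.
Qed.

End CkAlgebra.

(** * Complex coordinates and real derivatives *)

(** Unfolds complex differentiability into estimates, because limits over the
    complex field and over R live in different topological structures. *)
Lemma derivable_eps (K : numFieldType) (V W : normedModType K) (f : V -> W)
    (a v : V) : derivable f a v ->
  exists l : W, forall e : K, 0 < e -> exists2 d : K, 0 < d &
    forall h : K, h != 0 -> `|h| < d ->
      `|l - h^-1 *: (f (h *: v + a) - f a)| < e.
Proof.
move=> /cvg_ex[l /= Hl]; exists l => e e0.
move/cvgrPdist_lt : Hl => /(_ _ e0) /nbhs_ballP[d /= d0 Hd].
exists d => // h h0 hd.
by apply: Hd h0; rewrite -ball_normE /ball_/= sub0r normrN.
Qed.

Section ComplexCoordinate.
Context {R : realType}.
Implicit Types (w s : R * R) (z h l : Cplx R).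

Definition plane_to_C w : Cplx R := (w.1 +i* w.2)%C.
Definition C_to_plane z : R * R := (complex.Re z, complex.Im z).

(** The norm of a complex number is itself complex; this is its real value. *)
Definition modulus z : R := Num.sqrt (complex.Re z ^+ 2 + complex.Im z ^+ 2).

Lemma normE z : `|z| = (modulus z)%:C%C.
Proof. by case: z => a b; exact: normc_def. Qed.

Lemma modulus_lt z (e : R) : (`|z| < e%:C%C :> Cplx R) = (modulus z < e).
Proof. by rewrite normE ltcR. Qed.

Lemma Re_le_modulus z : `|complex.Re z| <= modulus z.
Proof.
rewrite -(@ler_pXn2r _ 2)// ?nnegrE ?sqrtr_ge0// sqr_sqrtr ?addr_ge0 ?sqr_ge0//.
by rewrite real_normK ?num_real// lerDl sqr_ge0.
Qed.

Lemma Im_le_modulus z : `|complex.Im z| <= modulus z.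
Proof.
rewrite -(@ler_pXn2r _ 2)// ?nnegrE ?sqrtr_ge0// sqr_sqrtr ?addr_ge0 ?sqr_ge0//.
by rewrite real_normK ?num_real// lerDr sqr_ge0.
Qed.

Lemma modulus_le z : modulus z <= `|complex.Re z| + `|complex.Im z|.
Proof.
rewrite -(@ler_pXn2r _ 2)// ?nnegrE ?sqrtr_ge0 ?addr_ge0// sqr_sqrtr ?addr_ge0 ?sqr_ge0//.
rewrite sqrrD !real_normK ?num_real// -addrA [_ *+ 2 + _]addrC addrA lerDl.
by rewrite mulrn_wge0// mulr_ge0.
Qed.

Lemma modulusM z h : modulus (z * h) = modulus z * modulus h.
Proof.
have : `|z * h| = `|z| * `|h| :> Cplx R by exact: normrM.
by rewrite !normE -rmorphM/= => -[].
Qed.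

Lemma Cplx_gt0 z : 0 < z -> exists2 e : R, 0 < e & z = e%:C%C.
Proof.
by case: z => a b; rewrite ltcE/= => /andP[/eqP-> a0]; exists a.
Qed.

Lemma realC_gt0 (e : R) : 0 < e -> 0 < (e%:C%C : Cplx R).
Proof. by rewrite ltcR. Qed.

Lemma continuous_plane_to_C : continuous plane_to_C.
Proof.
move=> w; apply/cvgrPdist_lt => _ /Cplx_gt0[e e0 ->].
have e20 : 0 < e / 2 by rewrite divr_gt0.
have /cvgrPdist_lt/(_ _ e20) h1 : fst z @[z --> w] --> w.1 by exact: cvg_fst.
have /cvgrPdist_lt/(_ _ e20) h2 : snd z @[z --> w] --> w.2 by exact: cvg_snd.
apply: filterS2 h1 h2 => z z1 z2; rewrite modulus_lt.
apply: le_lt_trans (modulus_le _) _; rewrite (splitr e); exact: ltrD.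
Qed.

Lemma C_derivable_eps (tau : Cplx R -> Cplx R) z : derivable tau z 1 ->
  exists l, forall e : R, 0 < e -> exists2 d : R, 0 < d &
    forall h, h != 0 -> modulus h < d ->
      modulus (l - h^-1 * (tau (h + z) - tau z)) < e.
Proof.
move=> /derivable_eps[l Hl]; exists l => e e0.
have [_ /Cplx_gt0[d d0 ->] Hd] := Hl _ (realC_gt0 e0).
exists d => // h h0 hd.
have := Hd h h0; rewrite !modulus_lt => /(_ hd).
by rewrite [h *: 1]mulr1.
Qed.

(** A difference quotient along e, with |e| = 1, is e times the complex quotient
    at t e, hence tends to e l; the choices e = 1 and e = i give the directions
    u and v. *)
Lemma cauchy_riemann (tau : Cplx R -> Cplx R) w :
  derivable tau (plane_to_C w) 1 ->
  let phi v := complex.Re (tau (plane_to_C v)) in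
  let psi v := complex.Im (tau (plane_to_C v)) in
  exists l : R * R, [/\ is_derive w du phi l.1, is_derive w du psi l.2,
    is_derive w dv phi (- l.2) & is_derive w dv psi l.1].
Proof.
move=> /C_derivable_eps[l Hl] phi psi.
have dir e : modulus e = 1 ->
    is_derive w (C_to_plane e) phi (complex.Re (e * l)) /\
    is_derive w (C_to_plane e) psi (complex.Im (e * l)).
  move=> e1.
  have lim0 (eps : R) : 0 < eps -> \forall t \near (0 : R)^',
    modulus (e * l - (t%:C)%C^-1 *
      (tau (plane_to_C (t *: C_to_plane e + w)) - tau (plane_to_C w))) < eps.
    move=> eps0; have [d d0 Hd] := Hl _ eps0.
    near=> t.
    have t0 : t != 0 by near: t; exact: nbhs_dnbhs_neq.
    have td : `|t| < d.
      by near: t; exact: dnbhs0_lt.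
    have tC0 : (t%:C)%C != 0 :> Cplx R by apply: contra t0 => /eqP[->].
    have te0 : (t%:C)%C * e != 0 :> Cplx R.
      rewrite mulf_neq0//; apply/eqP => e0; move: e1; rewrite e0 /modulus/=.
      by rewrite expr0n/= addr0 sqrtr0 => /eqP; rewrite eq_sym oner_eq0.
    have ted : modulus ((t%:C)%C * e) < d.
      by rewrite modulusM e1 mulr1 /modulus/= expr0n/= addr0 sqrtr_sqr.
    have := Hd _ te0 ted.
    have -> : plane_to_C (t *: C_to_plane e + w) = (t%:C)%C * e + plane_to_C w.
      by rewrite /plane_to_C /C_to_plane; case: (e) => a b; simpc.
    set D := tau _ - tau _ => hD.
    have E : (t%:C)%C^-1 = e * ((t%:C)%C * e)^-1.
      rewrite invfM mulrCA divff ?mulr1//.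
      by move: te0; rewrite mulf_eq0 negb_or => /andP[].
    rewrite E -mulrA -mulrBr.
    by rewrite modulusM e1 mul1r.
  split.
  - have C : (fun h : R => h^-1 *: ((phi \o shift w) (h *: C_to_plane e) - phi w))
        @ 0^' --> complex.Re (e * l).
      apply/cvgrPdist_lt => eps eps0; apply: filterS (lim0 _ eps0) => t.
      apply: le_lt_trans; apply: le_trans (Re_le_modulus _).
      rewrite /phi /=.
      set A := tau _; set B := tau _.
      have -> : (t%:C)%C^-1 = (t^-1)%:C%C :> Cplx R by rewrite fmorphV.
      by case: (e * l) => a1 a2; case: A => b1 b2; case: B => c1 c2; simpc.
    by apply: DeriveDef; [apply/cvg_ex; exists (complex.Re (e * l))|exact: cvg_lim C].
  - have C : (fun h : R => h^-1 *: ((psi \o shift w) (h *: C_to_plane e) - psi w))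
        @ 0^' --> complex.Im (e * l).
      apply/cvgrPdist_lt => eps eps0; apply: filterS (lim0 _ eps0) => t.
      apply: le_lt_trans; apply: le_trans (Im_le_modulus _).
      rewrite /psi /=.
      set A := tau _; set B := tau _.
      have -> : (t%:C)%C^-1 = (t^-1)%:C%C :> Cplx R by rewrite fmorphV.
      by case: (e * l) => a1 a2; case: A => b1 b2; case: B => c1 c2; simpc.
    by apply: DeriveDef; [apply/cvg_ex; exists (complex.Im (e * l))|exact: cvg_lim C].
have [] := dir 1; first by rewrite /modulus/= expr1n expr0n/= addr0 sqrtr1.
have [] := dir 'i%C; first by rewrite /modulus/= expr1n expr0n/= add0r sqrtr1.
have -> : C_to_plane 1 = du by [].
have -> : C_to_plane 'i%C = dv by [].
rewrite mul1r => h1 h2 h3 h4; exists (complex.Re l, complex.Im l); split => //=.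
- by move: h1; case: (l) => a b; simpc.
- by move: h2; case: (l) => a b; simpc.
Unshelve. all: by end_near. Qed.

End ComplexCoordinate.

(** * Independence of the normal from the chart *)

Section ChartChange.
Context {R : realType}.
Implicit Types (w s : R * R) (a b x : 'rV[R]_3).

Lemma open_local_dom (S : topologicalType) (c : @chart R S) : open (local_dom c).
Proof.
have -> : local_dom c = plane_to_C @^-1` cimg c by [].
apply: open_comp; last exact: cimg_open.
by move=> w _; exact: continuous_plane_to_C.
Qed.

(** A complex derivative p + i q acts on the pair (X_u, X_v) as a rotation composed
    with a dilation, of determinant p^2 + q^2. *)
Lemma cross_rotation (p q : R) a b :
  cross (p *: a + q *: b) (- q *: a + p *: b) = (p ^+ 2 + q ^+ 2) *: cross a b.
Proof.
apply/rowP => i; rewrite !mxE.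
by case: i => [[|[|[|//]]] ?]; rewrite /= ?mxE /=; ring.
Qed.

Lemma normalize_scale (k : R) a : 0 < k -> normalize (k *: a) = normalize a.
Proof.
move=> k0; rewrite /normalize /enorm.
have -> : ((k *: a) *m (k *: a)^T) 0 0 = k * (k * (a *m a^T) 0 0).
  by rewrite !mxE !mulr_sumr; apply: eq_bigr => j _; rewrite !mxE; ring.
rewrite mulrA -expr2 sqrtrM ?sqr_ge0// sqrtr_sqr gtr0_norm// scalerA.
by rewrite invfM mulrAC mulVf ?mul1r ?gt_eqF.
Qed.

Lemma to_lieD x a b (p q : R) :
  to_lie x (p *: a + q *: b) = p *: to_lie x a + q *: to_lie x b.
Proof. by rewrite /to_lie mulmxDl !scalemxAl. Qed.

Lemma row_combE n (a b : 'rV[R]_n) (p q : R) i :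
  (p *: a + q *: b) 0 i = p * a 0 i + q * b 0 i.
Proof. by rewrite !mxE. Qed.

Lemma derive_comp_plane n (U : set (R * R)) (F : R * R -> 'rV[R]_n)
    (phi psi : R * R -> R) w s (p q : R) :
  open U -> U (phi w, psi w) -> Ck_on 1 U F ->
  is_derive w s phi p -> is_derive w s psi q ->
  derivable (fun z => F (phi z, psi z)) w s /\
  'D_s (fun z => F (phi z, psi z)) w =
    p *: 'D_du F (phi w, psi w) + q *: 'D_dv F (phi w, psi w).
Proof.
move=> oU Uw CF [dphi Ephi] [dpsi Epsi].
have H i := pd_comp oU Uw ((Ck_on_coord _ _ oU).1 CF i) dphi dpsi.
have dF : derivable (fun z => F (phi z, psi z)) w s.
  by apply/derivable_mxP => j i; rewrite ord1; exact: (H i).1.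
split; first exact: dF.
apply/rowP => i; rewrite (derive_coord i dF).
rewrite [LHS](H i).2.
rewrite row_combE.
case: CF => _ [d1 d2 _ _].
rewrite (derive_coord i (d1 _ Uw)) (derive_coord i (d2 _ Uw)).
by rewrite /pd Ephi Epsi mulrC [X in _ + X]mulrC [X in X + _]mulrC [X in _ + X]mulrC.
Qed.

Lemma immersion_du_neq0 (F : R * R -> 'rV[R]_3) w :
  \rank (col_mx ('D_du F w) ('D_dv F w)) = 2%N -> 'D_du F w != 0.
Proof.
move=> rk; apply/eqP => D0; move: rk; rewrite D0 -addsmxE adds0mx => rk.
by have := rank_leq_row ('D_dv F w); rewrite rk.
Qed.

(** The derivative of the transition map cannot vanish, since otherwise X_u would
    vanish in the first chart; so the factor of [cross_rotation] is positive and
    disappears in the normalization. *)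
Lemma local_normal_chart (S : riemannSurface R) (X : S -> 'rV[R]_3) c c' w :
  immersion X -> @atlas R S c -> @atlas R S c' -> local_dom c w ->
  cdom c' (cinv c (plane_to_C w)) ->
  local_normal (local_rep c X) w =
  local_normal (local_rep c' X) (C_to_plane (cmap c' (cinv c (plane_to_C w)))).
Proof.
move=> [smX rkX] ac ac' cw c'w.
pose tau := cmap c' \o cinv c.
have [l [dphi dpsi dphi' dpsi']] : exists l : R * R,
    [/\ is_derive w du (fun v => complex.Re (tau (plane_to_C v))) l.1,
        is_derive w du (fun v => complex.Im (tau (plane_to_C v))) l.2,
        is_derive w dv (fun v => complex.Re (tau (plane_to_C v))) (- l.2) &
        is_derive w dv (fun v => complex.Im (tau (plane_to_C v))) l.1].
  by apply: cauchy_riemann; apply: (holomorphic_transition ac ac').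
set phi := (fun v => complex.Re _) in dphi dphi'.
set psi := (fun v => complex.Im _) in dpsi dpsi'.
set w' := C_to_plane _.
have w'E : w' = (phi w, psi w) by [].
have toK z : plane_to_C (C_to_plane z) = z by case: z.
have c'w' : local_dom c' w'.
  by rewrite /local_dom /=; rewrite -/(plane_to_C w') toK; exact: cmap_img.
(* both charts are defined near w, where they differ by tau *)
have FE : \forall z \near w, local_rep c' X (phi z, psi z) = local_rep c X z.
  have nd : \forall z \near w, cdom c' (cinv c (plane_to_C z)).
    have cc : {for w, continuous (cinv c \o plane_to_C)}.
      apply: continuous_comp; first exact: continuous_plane_to_C.
      exact: cinv_continuous.
    by apply: cc; apply: open_nbhs_nbhs; split => //; exact: cdom_open.
  apply: filterS nd => z dz; rewrite /local_rep; congr (X _).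
  rewrite -[RHS](cmapK dz); congr (cinv c' _).
  by rewrite /phi /psi /tau /=; case: (cmap c' _).
have oU : open (local_dom c') by exact: open_local_dom.
have CF := smX _ ac' 1%N.
have c'w2 : local_dom c' (phi w, psi w) by rewrite -w'E.
have [_ Du] := derive_comp_plane oU c'w2 CF dphi dpsi.
have [_ Dv] := derive_comp_plane oU c'w2 CF dphi' dpsi'.
rewrite (near_eq_derive _ FE) in Du; rewrite (near_eq_derive _ FE) in Dv.
have l0 : 0 < l.1 ^+ 2 + l.2 ^+ 2.
  rewrite lt_neqAle addr_ge0 ?sqr_ge0// andbT eq_sym paddr_eq0 ?sqr_ge0//.
  rewrite !sqrf_eq0; apply/negP => /andP[/eqP l1 /eqP l2].
  have /immersion_du_neq0/eqP := rkX _ ac _ cw; apply.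
  by rewrite Du l1 l2 !scale0r addr0.
have F0 : local_rep c X w = local_rep c' X (phi w, psi w).
  by rewrite -(nbhs_singleton FE).
rewrite /local_normal F0 Du Dv !to_lieD cross_rotation normalize_scale//.
Qed.

Lemma unit_normal_chart (S : riemannSurface R) (X : S -> 'rV[R]_3) c w :
  immersion X -> @atlas R S c -> local_dom c w ->
  unit_normal X (cinv c (plane_to_C w)) = local_normal (local_rep c X) w.
Proof.
move=> iX ac cw; apply/esym; apply: local_normal_chart => //.
- exact: chart_at_atlas.
- exact: chart_at_dom.
Qed.

End ChartChange.

(** * Algebra of conformal frames *)

Section PointwiseAlgebra.
Context {R : realType}.
Implicit Types a b : R.

(** With p = (P + i Q) / 2, P = a1 + b2 and Q = a2 - b1, the isotropic vector
    phi = (a - i b) / 2 satisfies conj(g) p = - phi_3: this is g solved for, with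
    [gauss_den] = P^2 + Q^2. *)
Definition gauss_den a1 a2 b1 b2 : R := (a1 + b2) * (a1 + b2) + (a2 - b1) * (a2 - b1).
Definition gauss_re a1 a2 a3 b1 b2 b3 : R :=
  - (a3 * (a1 + b2) - b3 * (a2 - b1)) * (gauss_den a1 a2 b1 b2)^-1.
Definition gauss_im a1 a2 a3 b1 b2 b3 : R :=
  - (a3 * (a2 - b1) + b3 * (a1 + b2)) * (gauss_den a1 a2 b1 b2)^-1.

Lemma gauss_den_gt0 a1 a2 b1 b2 : 0 < a1 * b2 - a2 * b1 -> 0 < gauss_den a1 a2 b1 b2.
Proof.
move=> h; rewrite (_ : gauss_den _ _ _ _ = a1 ^+ 2 + b2 ^+ 2 + (a2 ^+ 2 + b1 ^+ 2) +
  2 * (a1 * b2 - a2 * b1)); last by rewrite /gauss_den; ring.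
by rewrite ltr_wpDl ?mulr_gt0// !addr_ge0 ?sqr_ge0.
Qed.

(** The isotropy of phi = (a - i b) / 2 reads p q = - phi_3^2 with
    q = phi_1 - i phi_2; since phi_3 = - conj(g) p and p is nonzero, this gives
    q = - conj(g)^2 p.  The statement lists real and imaginary parts, A + i B
    being g^2. *)
Lemma weierstrass_representation a1 a2 a3 b1 b2 b3 (P Q g1 g2 : R) :
  a1 * a1 + a2 * a2 + a3 * a3 = b1 * b1 + b2 * b2 + b3 * b3 ->
  a1 * b1 + a2 * b2 + a3 * b3 = 0 ->
  0 < a1 * b2 - a2 * b1 ->
  P = a1 + b2 -> Q = a2 - b1 ->
  g1 = gauss_re a1 a2 a3 b1 b2 b3 -> g2 = gauss_im a1 a2 a3 b1 b2 b3 ->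
  let A := g1 * g1 - g2 * g2 in let B := 2 * g1 * g2 in
  [/\ a1 = (P - A * P - B * Q) / 2, a2 = (Q - B * P + A * Q) / 2,
      a3 = - (g1 * P + g2 * Q) &
   [/\ b1 = - (Q + B * P - A * Q) / 2, b2 = (P + A * P + B * Q) / 2 &
      b3 = - (g2 * P - g1 * Q)]].
Proof.
move=> cf1 cf2 c3 PE QE g1E g2E A B.
have D0 := gauss_den_gt0 c3; have D0' := lt0r_neq0 D0.
have DE : gauss_den a1 a2 b1 b2 = P * P + Q * Q by rewrite PE QE.
have a3E : a3 = - (g1 * P + g2 * Q).
  apply: (mulfI D0'); rewrite g1E g2E /gauss_re /gauss_im -PE -QE DE; field.
  by rewrite -DE.
have b3E : b3 = - (g2 * P - g1 * Q).
  apply: (mulfI D0'); rewrite g1E g2E /gauss_re /gauss_im -PE -QE DE; field.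
  by rewrite -DE.
have ME : a1 - b2 = - (A * P + B * Q).
  apply: (mulfI D0').
  have -> : gauss_den a1 a2 b1 b2 * (a1 - b2) = P * (b3 * b3 - a3 * a3) + 2 * Q * a3 * b3.
    have -> : b3 * b3 - a3 * a3 = a1 * a1 + a2 * a2 - b1 * b1 - b2 * b2.
      by move: cf1; clear; lra.
    have -> : 2 * Q * a3 * b3 = - 2 * Q * (a1 * b1 + a2 * b2).
      have -> : a1 * b1 + a2 * b2 = - (a3 * b3) by move: cf2; clear; lra.
      by ring.
    by rewrite PE QE /gauss_den; ring.
  by rewrite DE /A /B a3E b3E; ring.
have NE : a2 + b1 = - (B * P - A * Q).
  apply: (mulfI D0').
  have -> : gauss_den a1 a2 b1 b2 * (a2 + b1) = Q * (b3 * b3 - a3 * a3) - 2 * P * a3 * b3.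
    have -> : b3 * b3 - a3 * a3 = a1 * a1 + a2 * a2 - b1 * b1 - b2 * b2.
      by move: cf1; clear; lra.
    have -> : 2 * P * a3 * b3 = - 2 * P * (a1 * b1 + a2 * b2).
      have -> : a1 * b1 + a2 * b2 = - (a3 * b3) by move: cf2; clear; lra.
      by ring.
    by rewrite PE QE /gauss_den; ring.
  by rewrite DE /A /B a3E b3E; ring.
have e1 : a1 = (P + (a1 - b2)) / 2 by rewrite PE; field.
have e2 : a2 = (Q + (a2 + b1)) / 2 by rewrite QE; field.
have e3 : b1 = (a2 + b1 - Q) / 2 by rewrite QE; field.
have e4 : b2 = (P - (a1 - b2)) / 2 by rewrite PE; field.
rewrite NE in e2 e3; rewrite ME in e1 e4.
by split; [rewrite e1; field|rewrite e2; field| |split; [rewrite e3; field|rewrite e4; field|]].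
Qed.

(** In terms of g the vector a x b is k times (2 Re g, 2 Im g, 1 - |g|^2), so that g
    is its stereographic projection; |a|^2 equals |a x b|. *)
Lemma frame_invariants (P Q g1 g2 : R) :
  let A := g1 * g1 - g2 * g2 in let B := 2 * g1 * g2 in
  let a1 := (P - A * P - B * Q) / 2 in let a2 := (Q - B * P + A * Q) / 2 in
  let a3 := - (g1 * P + g2 * Q) in
  let b1 := - (Q + B * P - A * Q) / 2 in let b2 := (P + A * P + B * Q) / 2 in
  let b3 := - (g2 * P - g1 * Q) in
  let k := (P * P + Q * Q) * (1 + (g1 * g1 + g2 * g2)) / 4 in
  [/\ a2 * b3 - a3 * b2 = 2 * g1 * k, a3 * b1 - a1 * b3 = 2 * g2 * k,
      a1 * b2 - a2 * b1 = (1 - (g1 * g1 + g2 * g2)) * k &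
      a1 * a1 + a2 * a2 + a3 * a3 = (1 + (g1 * g1 + g2 * g2)) * k].
Proof. by cbv zeta; split; field. Qed.

(** These are the quadratic terms that the Levi-Civita connection contributes to the
    first two components of the tension of X. *)
Lemma frame_nonlinear_terms (P Q g1 g2 : R) :
  let A := g1 * g1 - g2 * g2 in let B := 2 * g1 * g2 in
  let a1 := (P - A * P - B * Q) / 2 in let a2 := (Q - B * P + A * Q) / 2 in
  let a3 := - (g1 * P + g2 * Q) in
  let b1 := - (Q + B * P - A * Q) / 2 in let b2 := (P + A * P + B * Q) / 2 in
  let b3 := - (g2 * P - g1 * Q) in
  let W := 1 - (g1 * g1 + g2 * g2) in
  let D := P * P + Q * Q in
  a2 * a3 + b2 * b3 = - (g2 * W * D / 2) /\
  a1 * a3 + b1 * b3 = - (g1 * W * D / 2).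
Proof. by cbv zeta; split; field. Qed.

(** With c = a x b, expanding t in the basis (a, b, c) by Cramer's rule multiplies
    it by det (a, b, c) = |c|^2. *)
Lemma orthogonal_to_frame a1 a2 a3 b1 b2 b3 (t1 t2 t3 : R) :
  0 < a1 * b2 - a2 * b1 ->
  t1 * a1 + t2 * a2 + t3 * a3 = 0 -> t1 * b1 + t2 * b2 + t3 * b3 = 0 ->
  t1 * (a2 * b3 - a3 * b2) + t2 * (a3 * b1 - a1 * b3) + t3 * (a1 * b2 - a2 * b1) = 0 ->
  [/\ t1 = 0, t2 = 0 & t3 = 0].
Proof.
set c1 := a2 * b3 - a3 * b2; set c2 := a3 * b1 - a1 * b3; set c3 := a1 * b2 - a2 * b1.
move=> c30 ta tb tc.
have n0 : c1 * c1 + c2 * c2 + c3 * c3 != 0.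
  by rewrite gt_eqF// ltr_wpDl ?mulr_gt0// addr_ge0// -expr2 sqr_ge0.
(* writes 0 as the combination of the hypotheses given by Cramer's rule *)
have z (p q r : R) : 0 = p * 0 + q * 0 + r * 0 by rewrite !mulr0 !addr0.
split; apply: (mulfI n0); rewrite mulr0.
- rewrite (z (b2 * c3 - b3 * c2) (c2 * a3 - c3 * a2) c1) -{1}ta -{1}tb -tc /c1 /c2 /c3; ring.
- rewrite (z (b3 * c1 - b1 * c3) (c3 * a1 - c1 * a3) c2) -{1}ta -{1}tb -tc /c1 /c2 /c3; ring.
- rewrite (z (b1 * c2 - b2 * c1) (c1 * a2 - c2 * a1) c3) -{1}ta -{1}tb -tc /c1 /c2 /c3; ring.
Qed.

(** Here X + i Y stands for 2 g_z, and S + i T for 4 p_zbar.  The last two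
    hypotheses are the third components of the minimality and structure
    equations, where phi_3 = - conj(g) p has been differentiated; they form a
    linear system for (X, Y) of determinant P^2 + Q^2. *)
Lemma solve_first_order (P Q X Y g1 g2 S T : R) :
  let W := 1 - (g1 * g1 + g2 * g2) in
  let D := P * P + Q * Q in
  D != 0 ->
  S = g2 * W * D / 2 -> T = - (g1 * W * D / 2) ->
  0 = - (X * P + Y * Q) - g1 * S - g2 * T ->
  - (W * (D * (1 + (g1 * g1 + g2 * g2)) / 4)) = - (Y * P - X * Q) - g2 * S + g1 * T ->
  X = - (W * W * Q / 4) /\ Y = W * W * P / 4.
Proof.
move=> W D D0 SE TE E1 E2.
have F1 : X * P + Y * Q = 0 by move: E1; rewrite SE TE; lra.
have F2 : X * Q - Y * P = - (D * W * W / 4).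
  have -> : X * Q - Y * P = - (W * (D * (1 + (g1 * g1 + g2 * g2)) / 4)) + g2 * S - g1 * T.
    by rewrite E2; ring.
  by rewrite SE TE /W; field.
split; apply: (mulfI D0).
- have -> : D * X = P * (X * P + Y * Q) + Q * (X * Q - Y * P) by rewrite /D; ring.
  by rewrite F1 F2; field.
- have -> : D * Y = Q * (X * P + Y * Q) - P * (X * Q - Y * P) by rewrite /D; ring.
  by rewrite F1 F2; field.
Qed.

(** The first order equations only constrain g_z; the derivative g_zbar, which is
    arbitrary, cancels after the Laplacians are expressed by derivatives of
    (1 - |g|^2)^2 p. *)
Lemma harmonic_identity (P Q g1 g2 g1u g1v g2u g2v Pu Pv Qu Qv Wu Wv
    g1uu g1uv g1vu g1vv g2uu g2uv g2vu g2vv : R) :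
  let W := 1 - (g1 * g1 + g2 * g2) in
  let D := P * P + Q * Q in
  W != 0 ->
  Pu - Qv = g2 * W * D / 2 -> Qu + Pv = - (g1 * W * D / 2) ->
  g1u + g2v = - (W * W * Q / 4) -> g2u - g1v = W * W * P / 4 ->
  Wu = - (2 * (g1 * g1u + g2 * g2u)) -> Wv = - (2 * (g1 * g1v + g2 * g2v)) ->
  g1uu + g2vu = - ((W * W * Qu + 2 * W * Wu * Q) / 4) ->
  g1uv + g2vv = - ((W * W * Qv + 2 * W * Wv * Q) / 4) ->
  g2uu - g1vu = (W * W * Pu + 2 * W * Wu * P) / 4 ->
  g2uv - g1vv = (W * W * Pv + 2 * W * Wv * P) / 4 ->
  g1uv = g1vu -> g2uv = g2vu ->
  let den := 1 - (g2 * g2 + g1 * g1) in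
  g1uu + 2 / W * (2 * g1u * (g1 * g1u + g2 * g2u) - g1 * (g1u * g1u + g2u * g2u)) +
    (g1vv + 2 / W * (2 * g1v * (g1 * g1v + g2 * g2v) - g1 * (g1v * g1v + g2v * g2v))) = 0
  /\
  g2uu + 2 / den * (2 * g2u * (g2 * g2u + g1 * g1u) - g2 * (g2u * g2u + g1u * g1u)) +
    (g2vv + 2 / den * (2 * g2v * (g2 * g2v + g1 * g1v) - g2 * (g2v * g2v + g1v * g1v))) = 0.
Proof.
move=> W D W0 SE TE XE YE -> -> Xu Xv Yu Yv m1 m2 den.
have -> : den = W by rewrite /den /W [g2 * g2 + _]addrC.
have g1uuE : g1uu = - ((W * W * Qu + 2 * W * - (2 * (g1 * g1u + g2 * g2u)) * Q) / 4)
  - g2vu by rewrite -Xu; ring.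
have g2vvE : g2vv = - ((W * W * Qv + 2 * W * - (2 * (g1 * g1v + g2 * g2v)) * Q) / 4)
  - g1vu by rewrite -Xv m1; ring.
have g2uuE : g2uu = (W * W * Pu + 2 * W * - (2 * (g1 * g1u + g2 * g2u)) * P) / 4 + g1vu.
  by rewrite -Yu; ring.
have g1vvE : g1vv = g2vu -
  (W * W * Pv + 2 * W * - (2 * (g1 * g1v + g2 * g2v)) * P) / 4.
  by rewrite -Yv m2; ring.
have QuE : Qu = - (g1 * W * D / 2) - Pv by rewrite -TE; ring.
have PuE : Pu = g2 * W * D / 2 + Qv by rewrite -SE; ring.
have g2vE : g2v = - (W * W * Q / 4) - g1u by rewrite -XE; ring.
have g2uE : g2u = W * W * P / 4 + g1v by rewrite -YE; ring.
rewrite g1uuE g2vvE g2uuE g1vvE QuE PuE g2vE g2uE /D.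
by split; rewrite /W; field.
Qed.

End PointwiseAlgebra.

(** * Conformal frames satisfying the minimal surface equations *)

Section DerivativeRules.
Context {R : realType}.
Implicit Types (f g : R * R -> R) (w s : R * R) (U : set (R * R)).

Lemma pd_eq U f g w s :
  open U -> U w -> (forall z, U z -> f z = g z) -> pd s f w = pd s g w.
Proof.
move=> oU Uw fg; apply: near_eq_derive.
have UU : \forall z \near w, U z by exact: open_nbhs_nbhs.
by apply: filterS UU => z; exact: fg.
Qed.

Definition direction (s : R * R) := s = du \/ s = dv.

Lemma direction_derivable U f w s : (forall k, Ck_on k U f) ->
  U w -> direction s -> derivable f w s.
Proof.
move=> Cf Uw; have [h1 h2] := Ck_on_derivable (Cf 1%N) Uw.
by case=> ->; [exact: h1|exact: h2].
Qed.

Lemma pd_cst (c : R) w s : pd s (fun=> c) w = 0.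
Proof. exact: derive_cst. Qed.

Lemma pd_dot (f1 f2 f3 g1 g2 g3 : R * R -> R) w s :
  derivable f1 w s -> derivable f2 w s -> derivable f3 w s ->
  derivable g1 w s -> derivable g2 w s -> derivable g3 w s ->
  pd s (fun z => f1 z * g1 z + f2 z * g2 z + f3 z * g3 z) w =
  f1 w * pd s g1 w + g1 w * pd s f1 w + (f2 w * pd s g2 w + g2 w * pd s f2 w) +
  (f3 w * pd s g3 w + g3 w * pd s f3 w).
Proof.
move=> d1 d2 d3 e1 e2 e3.
have p1 := derivableM d1 e1; have p2 := derivableM d2 e2; have p3 := derivableM d3 e3.
rewrite (pdD (derivableD p1 p2) p3) (pdD p1 p2).
by rewrite (pdM d1 e1) (pdM d2 e2) (pdM d3 e3).
Qed.

Lemma pd_lin (f1 f2 g1 g2 : R * R -> R) w s :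
  derivable f1 w s -> derivable f2 w s ->
  derivable g1 w s -> derivable g2 w s ->
  pd s (fun z => f1 z * g1 z + f2 z * g2 z) w =
  f1 w * pd s g1 w + g1 w * pd s f1 w + (f2 w * pd s g2 w + g2 w * pd s f2 w).
Proof.
move=> d1 d2 e1 e2.
by rewrite (pdD (derivableM d1 e1) (derivableM d2 e2)) (pdM d1 e1) (pdM d2 e2).
Qed.

Lemma pdN f w s : derivable f w s -> pd s (fun z => - f z) w = - pd s f w.
Proof. exact: deriveN. Qed.

Lemma pdB f g w s : derivable f w s -> derivable g w s ->
  pd s (fun z => f z - g z) w = pd s f w - pd s g w.
Proof. exact: deriveB. Qed.

Lemma derivable_prod f g w s : derivable f w s -> derivable g w s ->
  derivable (fun z => f z * g z) w s.
Proof. exact: derivableM. Qed.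

(** First component, in disk coordinates, of the covariant derivative for the
    hyperbolic metric of the s-derivative of (g, h) along s.  Exchanging g and h
    gives the second component. *)
Definition disk_second_derivative g h s w : R :=
  pd s (pd s g) w + 2 / (1 - (g w * g w + h w * h w)) *
    (2 * pd s g w * (g w * pd s g w + h w * pd s h w) -
       g w * (pd s g w * pd s g w + pd s h w * pd s h w)).

Definition disk_tension g h w : R :=
  disk_second_derivative g h du w + disk_second_derivative g h dv w.

End DerivativeRules.

(** The tension of a conformal map is normal: differentiate |a|^2 = |b|^2 and
    a . b = 0 along u and v, and exchange a_v for b_u by the structure equations.
    Below x, y stand for a, b, and the suffixes u, v for derivatives. *)
Lemma tangential_tension (R : realType) (x1 x2 x3 y1 y2 y3 x1u x2u x3u y1u y2u y3u
    x1v x2v x3v y1v y2v y3v : R) :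
  y1u = x1v -> y2u = x2v -> y3u - x3v = x2 * y1 - x1 * y2 ->
  x1 * x1u + x1 * x1u + (x2 * x2u + x2 * x2u) + (x3 * x3u + x3 * x3u) =
  y1 * y1u + y1 * y1u + (y2 * y2u + y2 * y2u) + (y3 * y3u + y3 * y3u) ->
  x1 * x1v + x1 * x1v + (x2 * x2v + x2 * x2v) + (x3 * x3v + x3 * x3v) =
  y1 * y1v + y1 * y1v + (y2 * y2v + y2 * y2v) + (y3 * y3v + y3 * y3v) ->
  x1 * y1u + y1 * x1u + (x2 * y2u + y2 * x2u) + (x3 * y3u + y3 * x3u) = 0 ->
  x1 * y1v + y1 * x1v + (x2 * y2v + y2 * x2v) + (x3 * y3v + y3 * x3v) = 0 ->
  (x1u + y1v + (x2 * x3 + y2 * y3)) * x1 + (x2u + y2v - (x1 * x3 + y1 * y3)) * x2 +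
    (x3u + y3v) * x3 = 0 /\
  (x1u + y1v + (x2 * x3 + y2 * y3)) * y1 + (x2u + y2v - (x1 * x3 + y1 * y3)) * y2 +
    (x3u + y3v) * y3 = 0.
Proof.
move=> -> -> E3.
have -> : y3u = x3v + (x2 * y1 - x1 * y2) by rewrite -E3; ring.
move=> E4 E5 E6 E7; split; lra.
Qed.

Section ConformalFrames.
Context {R : realType} (U : set (R * R)) (a1 a2 a3 b1 b2 b3 : R * R -> R).
Context (oU : open U).
Context (Ca1 : forall k, Ck_on k U a1) (Ca2 : forall k, Ck_on k U a2)
  (Ca3 : forall k, Ck_on k U a3) (Cb1 : forall k, Ck_on k U b1)
  (Cb2 : forall k, Ck_on k U b2) (Cb3 : forall k, Ck_on k U b3).
Context (mc1 : forall w, U w -> pd du b1 w = pd dv a1 w)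
  (mc2 : forall w, U w -> pd du b2 w = pd dv a2 w)
  (mc3 : forall w, U w -> pd du b3 w - pd dv a3 w = a2 w * b1 w - a1 w * b2 w).
Context (cf1 : forall w, U w -> a1 w * a1 w + a2 w * a2 w + a3 w * a3 w =
    b1 w * b1 w + b2 w * b2 w + b3 w * b3 w)
  (cf2 : forall w, U w -> a1 w * b1 w + a2 w * b2 w + a3 w * b3 w = 0)
  (up : forall w, U w -> 0 < a1 w * b2 w - a2 w * b1 w).
Context (min : forall w, U w ->
  (pd du a1 w + pd dv b1 w + (a2 w * a3 w + b2 w * b3 w)) *
    (a2 w * b3 w - a3 w * b2 w) +
  (pd du a2 w + pd dv b2 w - (a1 w * a3 w + b1 w * b3 w)) *
    (a3 w * b1 w - a1 w * b3 w) +
  (pd du a3 w + pd dv b3 w) * (a1 w * b2 w - a2 w * b1 w) = 0).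

(** The tension is orthogonal to a and b by conformality, and to a x b by
    minimality. *)
Lemma tension_components w : U w ->
  [/\ pd du a1 w + pd dv b1 w = - (a2 w * a3 w + b2 w * b3 w),
      pd du a2 w + pd dv b2 w = a1 w * a3 w + b1 w * b3 w &
      pd du a3 w + pd dv b3 w = 0].
Proof.
move=> Uw.
have d := @direction_derivable R U.
have DU : direction (@du R) by left.
have DV : direction (@dv R) by right.
have norm_eq s : direction s ->
  a1 w * pd s a1 w + a1 w * pd s a1 w + (a2 w * pd s a2 w + a2 w * pd s a2 w) +
    (a3 w * pd s a3 w + a3 w * pd s a3 w) =
  b1 w * pd s b1 w + b1 w * pd s b1 w + (b2 w * pd s b2 w + b2 w * pd s b2 w) +
    (b3 w * pd s b3 w + b3 w * pd s b3 w).
  move=> Ds.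
  have h1 := d _ _ _ Ca1 Uw Ds; have h2 := d _ _ _ Ca2 Uw Ds.
  have h3 := d _ _ _ Ca3 Uw Ds; have k1 := d _ _ _ Cb1 Uw Ds.
  have k2 := d _ _ _ Cb2 Uw Ds; have k3 := d _ _ _ Cb3 Uw Ds.
  rewrite -(pd_dot h1 h2 h3 h1 h2 h3) -(pd_dot k1 k2 k3 k1 k2 k3).
  by apply: (pd_eq _ oU Uw).
have orth s : direction s ->
  a1 w * pd s b1 w + b1 w * pd s a1 w + (a2 w * pd s b2 w + b2 w * pd s a2 w) +
    (a3 w * pd s b3 w + b3 w * pd s a3 w) = 0.
  move=> Ds.
  have h1 := d _ _ _ Ca1 Uw Ds; have h2 := d _ _ _ Ca2 Uw Ds.
  have h3 := d _ _ _ Ca3 Uw Ds; have k1 := d _ _ _ Cb1 Uw Ds.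
  have k2 := d _ _ _ Cb2 Uw Ds; have k3 := d _ _ _ Cb3 Uw Ds.
  rewrite -(pd_dot h1 h2 h3 k1 k2 k3) -(pd_cst 0 w s).
  by apply: (pd_eq _ oU Uw).
have [ta tb] := tangential_tension (mc1 Uw) (mc2 Uw) (mc3 Uw)
  (norm_eq _ DU) (norm_eq _ DV) (orth _ DU) (orth _ DV).
have [t1 t2 t3] := orthogonal_to_frame (up Uw) ta tb (min Uw).
split; [|exact: subr0_eq t2|exact: t3].
by apply/eqP; rewrite -addr_eq0; exact/eqP.
Qed.

(** Twice the real and imaginary parts of phi_1 + i phi_2. *)
Definition frameP w := a1 w + b2 w.
Definition frameQ w := a2 w - b1 w.
Definition gaussG1 w := gauss_re (a1 w) (a2 w) (a3 w) (b1 w) (b2 w) (b3 w).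
Definition gaussG2 w := gauss_im (a1 w) (a2 w) (a3 w) (b1 w) (b2 w) (b3 w).
Definition disk_room w := 1 - (gaussG1 w * gaussG1 w + gaussG2 w * gaussG2 w).

Lemma Ck_frameP k : Ck_on k U frameP.
Proof. exact: Ck_onD. Qed.

Lemma Ck_frameQ k : Ck_on k U frameQ.
Proof. by apply: Ck_onD => //; exact: Ck_onN. Qed.

Lemma Ck_den k : Ck_on k U (fun w => (gauss_den (a1 w) (a2 w) (b1 w) (b2 w))^-1).
Proof.
apply: Ck_onV => //; first by move=> w Uw; rewrite lt0r_neq0// gauss_den_gt0// up.
by apply: (Ck_onD oU); apply: (Ck_onM oU); first [exact: Ck_frameP|exact: Ck_frameQ].
Qed.

Lemma Ck_gaussG1 k : Ck_on k U gaussG1.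
Proof.
apply: (Ck_onM oU); last exact: Ck_den.
apply: (Ck_onN oU); apply: (Ck_onD oU); last apply: (Ck_onN oU);
  apply: (Ck_onM oU); first [exact: Ck_frameP|exact: Ck_frameQ|exact: Ca3|exact: Cb3].
Qed.

Lemma Ck_gaussG2 k : Ck_on k U gaussG2.
Proof.
apply: (Ck_onM oU); last exact: Ck_den.
apply: (Ck_onN oU); apply: (Ck_onD oU);
  apply: (Ck_onM oU); first [exact: Ck_frameP|exact: Ck_frameQ|exact: Ca3|exact: Cb3].
Qed.

Lemma Ck_disk_room k : Ck_on k U disk_room.
Proof.
apply: (Ck_onD oU); first exact: Ck_on_cst.
apply: (Ck_onN oU); apply: (Ck_onD oU);
  apply: (Ck_onM oU); first [exact: Ck_gaussG1|exact: Ck_gaussG2].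
Qed.

Lemma frame_weierstrass w : U w ->
  let A := gaussG1 w * gaussG1 w - gaussG2 w * gaussG2 w in let B := 2 * gaussG1 w * gaussG2 w in
  [/\ a1 w = (frameP w - A * frameP w - B * frameQ w) / 2,
      a2 w = (frameQ w - B * frameP w + A * frameQ w) / 2,
      a3 w = - (gaussG1 w * frameP w + gaussG2 w * frameQ w) &
   [/\ b1 w = - (frameQ w + B * frameP w - A * frameQ w) / 2,
      b2 w = (frameP w + A * frameP w + B * frameQ w) / 2 &
      b3 w = - (gaussG2 w * frameP w - gaussG1 w * frameQ w)]].
Proof.
by move=> Uw; exact: weierstrass_representation (cf1 Uw) (cf2 Uw) (up Uw) _ _ _ _.
Qed.

Lemma den_neq0 w : U w -> frameP w * frameP w + frameQ w * frameQ w != 0.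
Proof. by move=> Uw; apply/lt0r_neq0/gauss_den_gt0/up. Qed.

Lemma frame_normal w : U w ->
  let k := (frameP w * frameP w + frameQ w * frameQ w) *
    (1 + (gaussG1 w * gaussG1 w + gaussG2 w * gaussG2 w)) / 4 in
  [/\ a2 w * b3 w - a3 w * b2 w = 2 * gaussG1 w * k,
      a3 w * b1 w - a1 w * b3 w = 2 * gaussG2 w * k,
      a1 w * b2 w - a2 w * b1 w = disk_room w * k &
      a1 w * a1 w + a2 w * a2 w + a3 w * a3 w =
        (1 + (gaussG1 w * gaussG1 w + gaussG2 w * gaussG2 w)) * k].
Proof.
move=> Uw; have [-> -> -> [-> -> ->]] := frame_weierstrass Uw.
exact: frame_invariants.
Qed.

Lemma disk_room_gt0 w : U w -> 0 < disk_room w.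
Proof.
move=> Uw; have [_ _ E _] := frame_normal Uw; have := up Uw; rewrite E.
have g0 : 0 <= gaussG1 w * gaussG1 w + gaussG2 w * gaussG2 w.
  by rewrite addr_ge0// -expr2 sqr_ge0.
rewrite pmulr_lgt0// divr_gt0// mulr_gt0//; last by rewrite ltr_wpDr.
exact: gauss_den_gt0 (up Uw).
Qed.

(** The equation p_zbar = - (i / 2) g (1 - |g|^2) |p|^2: the derivatives of a1, a2,
    b1, b2 combine into the first two components of the tension. *)
Lemma frame_dbar w : U w ->
  pd du frameP w - pd dv frameQ w =
    gaussG2 w * disk_room w * (frameP w * frameP w + frameQ w * frameQ w) / 2 /\
  pd du frameQ w + pd dv frameP w =
    - (gaussG1 w * disk_room w * (frameP w * frameP w + frameQ w * frameQ w) / 2).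
Proof.
move=> Uw.
have DU : direction (@du R) by left.
have DV : direction (@dv R) by right.
have d := @direction_derivable R U.
rewrite /frameP /frameQ.
rewrite (pdD (d _ _ _ Ca1 Uw DU) (d _ _ _ Cb2 Uw DU)).
rewrite (pdD (d _ _ _ Ca1 Uw DV) (d _ _ _ Cb2 Uw DV)).
rewrite (pdB (d _ _ _ Ca2 Uw DU) (d _ _ _ Cb1 Uw DU)).
rewrite (pdB (d _ _ _ Ca2 Uw DV) (d _ _ _ Cb1 Uw DV)).
rewrite -/(frameP w) -/(frameQ w) (mc1 Uw) (mc2 Uw).
have [E1 E2 _] := tension_components Uw.
have [N1 N2] : a2 w * a3 w + b2 w * b3 w =
     - (gaussG2 w * disk_room w * (frameP w * frameP w + frameQ w * frameQ w) / 2) /\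
   a1 w * a3 w + b1 w * b3 w =
     - (gaussG1 w * disk_room w * (frameP w * frameP w + frameQ w * frameQ w) / 2).
  have [-> -> -> [-> -> ->]] := frame_weierstrass Uw.
  exact: frame_nonlinear_terms.
rewrite N1 opprK in E1; rewrite N2 in E2; rewrite -E1 -E2.
by split; [rewrite opprB addrACA subrr addr0|rewrite addrA subrK].
Qed.

(** The equation g_z = (i / 4) (1 - |g|^2)^2 p. *)
Lemma gauss_first_order w : U w ->
  pd du gaussG1 w + pd dv gaussG2 w = - (disk_room w * disk_room w * frameQ w / 4) /\
  pd du gaussG2 w - pd dv gaussG1 w = disk_room w * disk_room w * frameP w / 4.
Proof.
move=> Uw.
have DU : direction (@du R) by left.
have DV : direction (@dv R) by right.
have d f s (Cf : forall k, Ck_on k U f) := @direction_derivable R U f w s Cf Uw.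
have Ea3 s : direction s -> pd s a3 w =
    - (gaussG1 w * pd s frameP w + frameP w * pd s gaussG1 w +
       (gaussG2 w * pd s frameQ w + frameQ w * pd s gaussG2 w)).
  move=> Ds.
  have p1 := derivableM (d _ _ Ck_gaussG1 Ds) (d _ _ Ck_frameP Ds).
  have p2 := derivableM (d _ _ Ck_gaussG2 Ds) (d _ _ Ck_frameQ Ds).
  rewrite -(pd_lin (d _ _ Ck_gaussG1 Ds) (d _ _ Ck_gaussG2 Ds)
    (d _ _ Ck_frameP Ds) (d _ _ Ck_frameQ Ds)).
  rewrite -(pdN (derivableD p1 p2)).
  by apply: (pd_eq _ oU Uw) => // z Uz; have [_ _ ->] := frame_weierstrass Uz.
have Eb3 s : direction s -> pd s b3 w =
    - (gaussG2 w * pd s frameP w + frameP w * pd s gaussG2 w -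
       (gaussG1 w * pd s frameQ w + frameQ w * pd s gaussG1 w)).
  move=> Ds.
  rewrite -(pdM (d _ _ Ck_gaussG2 Ds) (d _ _ Ck_frameP Ds)).
  rewrite -(pdM (d _ _ Ck_gaussG1 Ds) (d _ _ Ck_frameQ Ds)).
  have p1 := derivableM (d _ _ Ck_gaussG2 Ds) (d _ _ Ck_frameP Ds).
  have p2 := derivableM (d _ _ Ck_gaussG1 Ds) (d _ _ Ck_frameQ Ds).
  rewrite -(pdB p1 p2) -(pdN (derivableB p1 p2)).
  by apply: (pd_eq _ oU Uw) => // z Uz; have [_ _ _ [_ _ ->]] := frame_weierstrass Uz.
have [S T] := frame_dbar Uw.
have [_ _ t3] := tension_components Uw.
have m3 := mc3 Uw.
have [_ _ c3 _] := frame_normal Uw.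
apply: (solve_first_order (den_neq0 Uw) S T).
- rewrite -t3 (Ea3 _ DU) (Eb3 _ DV).
  move: (pd _ _ _) (pd _ _ _) (pd _ _ _) (pd _ _ _) (pd _ _ _) (pd _ _ _)
    (pd _ _ _) (pd _ _ _) (gaussG1 w) (gaussG2 w) (frameP w) (frameQ w) => *; ring.
- rewrite -[W in - (W * _)]/(disk_room w) -c3 opprB -m3 (Eb3 _ DU) (Ea3 _ DV).
  move: (pd _ _ _) (pd _ _ _) (pd _ _ _) (pd _ _ _) (pd _ _ _) (pd _ _ _)
    (pd _ _ _) (pd _ _ _) (gaussG1 w) (gaussG2 w) (frameP w) (frameQ w) => *; ring.
Qed.

Lemma pd_disk_room w s : U w -> direction s ->
  pd s disk_room w = - (2 * (gaussG1 w * pd s gaussG1 w + gaussG2 w * pd s gaussG2 w)).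
Proof.
move=> Uw Ds.
have d1 := direction_derivable Ck_gaussG1 Uw Ds.
have d2 := direction_derivable Ck_gaussG2 Uw Ds.
have dd := derivableD (derivableM d1 d1) (derivableM d2 d2).
rewrite /disk_room (pdB (derivable_cst _ _ _) dd) pd_cst (pd_lin d1 d2 d1 d2).
by move: (pd _ _ _) (pd _ _ _) => *; ring.
Qed.

Lemma pd_disk_room_sqr f w s : (forall k, Ck_on k U f) -> U w -> direction s ->
  pd s (fun z => disk_room z * disk_room z * f z / 4) w =
  (disk_room w * disk_room w * pd s f w + 2 * disk_room w * pd s disk_room w * f w) / 4.
Proof.
move=> Cf Uw Ds.
have dW := direction_derivable Ck_disk_room Uw Ds.
have df := direction_derivable Cf Uw Ds.
have dWW := derivable_prod dW dW.
have dWWf := derivable_prod dWW df.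
have d4 : derivable (fun=> 4^-1 : R) w s by exact: derivable_cst.
rewrite (pdM dWWf d4) pd_cst (pdM dWW df) (pdM dW dW).
by move: (pd s f w) (pd s disk_room w) (disk_room w) (f w) => *; field.
Qed.

Lemma gauss_harmonic w : U w ->
  disk_tension gaussG1 gaussG2 w = 0 /\ disk_tension gaussG2 gaussG1 w = 0.
Proof.
move=> Uw.
have DU : direction (@du R) by left.
have DV : direction (@dv R) by right.
have [S T] := frame_dbar Uw.
have [XE YE] := gauss_first_order Uw.
have Cu f : (forall k, Ck_on k U f) -> forall k, Ck_on k U (pd du f).
  by move=> Cf k; exact: (Ck_on_pd (Cf k.+1)).1.
have Cv f : (forall k, Ck_on k U f) -> forall k, Ck_on k U (pd dv f).
  by move=> Cf k; exact: (Ck_on_pd (Cf k.+1)).2.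
have d f s (Cf : forall k, Ck_on k U f) := @direction_derivable R U f w s Cf Uw.
have X s : direction s -> pd s (pd du gaussG1) w + pd s (pd dv gaussG2) w =
    - ((disk_room w * disk_room w * pd s frameQ w +
        2 * disk_room w * pd s disk_room w * frameQ w) / 4).
  move=> Ds; rewrite -(pd_disk_room_sqr Ck_frameQ Uw Ds).
  rewrite -(pdD (d _ _ (Cu _ Ck_gaussG1) Ds) (d _ _ (Cv _ Ck_gaussG2) Ds)).
  rewrite -pdN; first by apply: (pd_eq _ oU Uw) => z Uz; have [] := gauss_first_order Uz.
  have dW := d _ _ Ck_disk_room Ds.
  exact: (derivable_prod (derivable_prod (derivable_prod dW dW) (d _ _ Ck_frameQ Ds))
    (derivable_cst _ _ _)).
have Y s : direction s -> pd s (pd du gaussG2) w - pd s (pd dv gaussG1) w =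
    (disk_room w * disk_room w * pd s frameP w +
     2 * disk_room w * pd s disk_room w * frameP w) / 4.
  move=> Ds; rewrite -(pd_disk_room_sqr Ck_frameP Uw Ds).
  rewrite -(pdB (d _ _ (Cu _ Ck_gaussG2) Ds) (d _ _ (Cv _ Ck_gaussG1) Ds)).
  by apply: (pd_eq _ oU Uw) => z Uz; have [] := gauss_first_order Uz.
have m1 := mixed_partials oU Uw (Ck_gaussG1 2).
have m2 := mixed_partials oU Uw (Ck_gaussG2 2).
exact: (harmonic_identity (lt0r_neq0 (disk_room_gt0 Uw)) S T XE YE (pd_disk_room Uw DU)
  (pd_disk_room Uw DV) (X _ DU) (X _ DV) (Y _ DU) (Y _ DV) m1 m2).
Qed.

End ConformalFrames.

(** * The Levi-Civita connection of Nil_3 in the left-invariant frame *)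

Section Nil3Coordinates.
Context {R : realType}.
Implicit Types (x a b v : 'rV[R]_3) (w s t : R * R) (F : R * R -> 'rV[R]_3).

Lemma ord3_ind (P : 'I_3 -> Prop) : P 0 -> P 1 -> P 2 -> forall i, P i.
Proof.
move=> P0 P1 P2 [[|[|[|//]]] Hi].
- by rewrite (_ : Ordinal Hi = 0)//; apply/val_inj.
- by rewrite (_ : Ordinal Hi = 1)//; apply/val_inj.
- by rewrite (_ : Ordinal Hi = 2)//; apply/val_inj.
Qed.

Lemma sum3 (V : nmodType) (f : 'I_3 -> V) : \sum_i f i = f 0 + f 1 + f 2.
Proof.
rewrite !big_ord_recl big_ord0 addr0 addrA.
by congr (_ + _ + _); congr f; apply/val_inj.
Qed.

Lemma row3_0 (p q r : R) : row3 p q r 0 0 = p. Proof. by rewrite mxE. Qed.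
Lemma row3_1 (p q r : R) : row3 p q r 0 1 = q. Proof. by rewrite mxE. Qed.
Lemma row3_2 (p q r : R) : row3 p q r 0 2 = r. Proof. by rewrite mxE. Qed.
Definition row3E := (row3_0, row3_1, row3_2).

Lemma nil_frame_row0 x k : nil_frame x 0 k = nil_E1 x 0 k.
Proof. by rewrite mxE. Qed.
Lemma nil_frame_row1 x k : nil_frame x 1 k = nil_E2 x 0 k.
Proof. by rewrite mxE. Qed.
Lemma nil_frame_row2 x k : nil_frame x 2 k = nil_E3 x 0 k.
Proof. by rewrite mxE. Qed.
Definition nil_frameE := (nil_frame_row0, nil_frame_row1, nil_frame_row2).

Lemma nil_frame_unit x : nil_frame x \in unitmx.
Proof.
have := nil_frame_orthonormal x; rewrite -mulmxA => /mulmx1_unit[].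
by [].
Qed.

Lemma nil_invmx x : invmx (nil_metric x) = (nil_frame x)^T *m nil_frame x.
Proof.
have E := nil_frame_orthonormal x.
have uE := nil_frame_unit x; have uET : (nil_frame x)^T \in unitmx by rewrite unitmx_tr.
have inv : (nil_frame x)^T *m nil_frame x *m nil_metric x = 1%:M.
  apply: (can_inj (mulmxK uET)); rewrite mul1mx -!mulmxA.
  by rewrite [nil_frame x *m _]mulmxA E mulmx1.
have [_ um] := mulmx1_unit inv.
by rewrite -[RHS](mulmxK um) inv mul1mx.
Qed.

Lemma to_lieE x a : to_lie x a =
  row3 (a 0 0) (a 0 1) (a 0 2 + (x 0 1 * a 0 0 - x 0 0 * a 0 1) / 2).
Proof.
apply: (can_inj (mulmxK (nil_frame_unit x))).
rewrite /to_lie (mulmxKV (nil_frame_unit x)); apply/rowP.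
by apply: ord3_ind; rewrite mxE sum3 !nil_frameE !row3E; field.
Qed.

Lemma to_lieK x a : to_lie x (of_lie x a) = a.
Proof. exact: mulmxK (nil_frame_unit x) _. Qed.

Lemma nil_metric_lie x : nil_metric x = invmx (nil_frame x) *m (invmx (nil_frame x))^T.
Proof.
have uE := nil_frame_unit x.
have E := nil_frame_orthonormal x.
apply: (can_inj (mulKmx uE)); rewrite mulKVmx//.
have uET : (nil_frame x)^T \in unitmx by rewrite unitmx_tr.
by apply: (can_inj (mulmxK uET)); rewrite E trmx_inv mulVmx.
Qed.

Lemma inner_nil x a b : inner nil_metric x a b =
  to_lie x a 0 0 * to_lie x b 0 0 + to_lie x a 0 1 * to_lie x b 0 1 +
  to_lie x a 0 2 * to_lie x b 0 2.
Proof.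
rewrite /inner nil_metric_lie mulmxA -mulmxA -trmx_mul -/(to_lie x a) -/(to_lie x b).
by rewrite mxE sum3 !mxE.
Qed.

Lemma is_derive_coord n (x v : 'rV[R]_n) (i : 'I_n) :
  is_derive x v (fun y : 'rV[R]_n => y 0 i) (v 0 i).
Proof.
have did : derivable (@idfun 'rV[R]_n) x v by exact: derivable_id.
apply: DeriveDef; first by move: did => /derivable_mxP; exact.
have := derive_mx did; rewrite derive_id => /matrixP /(_ 0 i).
by rewrite mxE => <-.
Qed.

(** Derivative along v of the 1-form [nil_form], whose coefficients are affine; the
    metric is constant up to the square of this form. *)
Definition nil_dform v : 'rV[R]_3 := row3 (v 0 1 / 2) (- (v 0 0 / 2)) 0.

Lemma is_derive_form x v (p : 'I_3) :
  is_derive x v (fun y => nil_form y 0 p) (nil_dform v 0 p).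
Proof.
have h (i : 'I_3) : is_derive x v (fun y : 'rV[R]_3 => y 0 i / 2) (v 0 i / 2).
  have d := is_derive_coord x v i.
  have := is_deriveM d (is_derive_cst (2^-1 : R) x v).
  by rewrite scaler0 add0r => H; apply: is_derive_eq; rewrite mulrC.
have E0 : (fun y : 'rV[R]_3 => nil_form y 0 0) = (fun y => y 0 1 / 2).
  by apply: funext => y; rewrite row3E.
have E1 : (fun y : 'rV[R]_3 => nil_form y 0 1) = (fun y => - (y 0 0 / 2)).
  by apply: funext => y; rewrite row3E.
have E2 : (fun y : 'rV[R]_3 => nil_form y 0 2) = (fun=> 1).
  by apply: funext => y; rewrite row3E.
move: p; apply: ord3_ind; rewrite row3E.
- by rewrite E0; exact: h.
- by rewrite E1; have := h 0 => H; exact: is_deriveN.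
- by rewrite E2; exact: is_derive_cst.
Qed.

Lemma derive_nil_metric x v (p q : 'I_3) :
  'D_v (fun y => nil_metric y p q) x =
  nil_form x 0 p * nil_dform v 0 q + nil_form x 0 q * nil_dform v 0 p.
Proof.
have -> : (fun y : 'rV[R]_3 => nil_metric y p q) =
    (fun y : 'rV[R]_3 => diag_mx (row3 1 1 0) p q + nil_form y 0 p * nil_form y 0 q).
  by apply: funext => y; rewrite mxE; congr (_ + _); rewrite mxE big_ord1 mxE.
have h1 := is_derive_form x v p; have h2 := is_derive_form x v q.
have := is_deriveD (is_derive_cst (diag_mx (row3 1 1 0) p q : R) x v) (is_deriveM h1 h2).
by rewrite add0r => -[_ ->].
Qed.

Lemma nil_christoffelE x (k i j : 'I_3) : christoffel nil_metric x k i j =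
  2^-1 * \sum_(l < 3)
    (nil_E1 x 0 k * nil_E1 x 0 l + nil_E2 x 0 k * nil_E2 x 0 l + nil_E3 x 0 k * nil_E3 x 0 l) *
    (nil_form x 0 j * nil_dform (delta_mx 0 i) 0 l + nil_form x 0 l * nil_dform (delta_mx 0 i) 0 j
     + (nil_form x 0 i * nil_dform (delta_mx 0 j) 0 l + nil_form x 0 l * nil_dform (delta_mx 0 j) 0 i)
     - (nil_form x 0 i * nil_dform (delta_mx 0 l) 0 j + nil_form x 0 j * nil_dform (delta_mx 0 l) 0 i)).
Proof.
rewrite /christoffel nil_invmx; congr (_ * _); apply: eq_bigr => l _.
rewrite !derive_nil_metric; congr (_ * _).
by rewrite mxE sum3 ![(nil_frame x)^T _ _]mxE !nil_frameE.
Qed.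

Lemma delta_row (i j : 'I_3) : (delta_mx 0 i : 'rV[R]_3) 0 j = (j == i)%:R.
Proof. by rewrite mxE. Qed.

Lemma eqI3 : (((0 : 'I_3) == 1) = false) * (((0 : 'I_3) == 2) = false) *
  (((1 : 'I_3) == 0) = false) * (((1 : 'I_3) == 2) = false).
Proof. by []. Qed.

(** The connection term of a geodesic, for a tangent vector a at x.  In the
    left-invariant frame it is (A2 A3, - A1 A3, 0), where A is the vector a in that
    frame; the third coordinate below is what becomes 0 there. *)
Lemma nil_christoffel x a (k : 'I_3) :
  \sum_(i < 3) \sum_(j < 3) christoffel nil_metric x k i j * a 0 i * a 0 j =
  let A3 := a 0 2 + (x 0 1 * a 0 0 - x 0 0 * a 0 1) / 2 in
  row3 (a 0 1 * A3) (- (a 0 0 * A3))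
       (- (A3 * (x 0 0 * a 0 0 + x 0 1 * a 0 1) / 2)) 0 k.
Proof.
cbv zeta; rewrite !sum3 !nil_christoffelE !sum3 /nil_dform !delta_row !eqxx !eqI3.
rewrite /nil_form /nil_E1 /nil_E2 /nil_E3.
move: k; apply: ord3_ind; rewrite !row3E;
  move: (x 0 0) (x 0 1) (a 0 0) (a 0 1) (a 0 2) => *; by rewrite /=; field.
Qed.

End Nil3Coordinates.

Lemma cross_row3 (R : realType) (p1 p2 p3 q1 q2 q3 : R) :
  cross (row3 p1 p2 p3) (row3 q1 q2 q3) =
  row3 (p2 * q3 - p3 * q2) (p3 * q1 - p1 * q3) (p1 * q2 - p2 * q1).
Proof. by rewrite /cross !row3E. Qed.

(** * Derivatives of a surface in the Lie algebra *)

Lemma inner_nil_row3 (R : realType) (x a b : 'rV[R]_3) (p1 p2 p3 q1 q2 q3 : R) :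
  to_lie x a = row3 p1 p2 p3 -> to_lie x b = row3 q1 q2 q3 ->
  inner nil_metric x a b = p1 * q1 + p2 * q2 + p3 * q3.
Proof. by move=> Ea Eb; rewrite inner_nil Ea Eb !row3E. Qed.

Lemma conformal_mean_curvature (R : realFieldType) (E A B C : R) : E != 0 ->
  (E * A - 2 * 0 * C + E * B) / (2 * (E * E - 0 ^+ 2)) = 0 -> B + A = 0.
Proof.
move=> E0 /eqP; rewrite mulf_eq0 invr_eq0 mulr0 mul0r subr0 expr0n/= subr0.
by rewrite -mulrDr !mulf_eq0 (negPf E0) /= pnatr_eq0/= orbF addrC => /eqP.
Qed.

Section NablaCoordinates.
Context {R : realType} {n : nat}.
Implicit Types (w s t : R * R) (F : R * R -> 'rV[R]_n) (U : set (R * R)).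

Lemma derivable_direction (V : normedModType R) k U (F : R * R -> V) w s :
  Ck_on k.+1 U F -> U w -> direction s -> derivable F w s.
Proof.
by move=> [_ [d1 d2 _ _]] Uw; case=> ->; [exact: d1|exact: d2].
Qed.

Lemma Ck_on_derive (V : normedModType R) k U (F : R * R -> V) s :
  Ck_on k.+1 U F -> direction s -> Ck_on k U ('D_s F).
Proof. by move=> [_ [_ _ C1 C2]]; case=> ->; [exact: C1|exact: C2]. Qed.

Lemma derive2_coord U F w s t (k : 'I_n) : open U -> U w -> Ck_on 2 U F ->
  direction s -> direction t ->
  ('D_s ('D_t F) w) 0 k = pd s (pd t (fun z => F z 0 k)) w.
Proof.
move=> oU Uw CF Ds Dt.
rewrite (derive_coord k (derivable_direction (Ck_on_derive CF Dt) Uw Ds)).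
apply: (pd_eq _ oU Uw) => z Uz.
have dF := derivable_direction CF Uz Dt. exact: (derive_coord k dF).
Qed.

Lemma nabla_coord met U F w s (k : 'I_n) : open U -> U w -> Ck_on 2 U F ->
  direction s ->
  nabla met F s s w 0 k = pd s (pd s (fun z => F z 0 k)) w +
   \sum_(i < n) \sum_(j < n) christoffel met (F w) k i j *
     'D_s F w 0 i * 'D_s F w 0 j.
Proof.
move=> oU Uw CF Ds; rewrite /nabla.
rewrite -(derive2_coord k oU Uw CF Ds Ds).
move: ('D_s ('D_s F) w) => T.
by rewrite mxE; congr (_ + _); rewrite mxE.
Qed.

End NablaCoordinates.

Section FrameOfSurface.
Context {R : realType} (U : set (R * R)) (F : R * R -> 'rV[R]_3).
Context (oU : open U) (CF : forall k, Ck_on k U F).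
Implicit Types (w s t : R * R).

Let f (i : 'I_3) w : R := F w 0 i.

(** Component along E3 of the derivative of F along s; the components along E1 and
    E2 are the derivatives of the coordinates x1 and x2 themselves. *)
Definition lie3 s w : R :=
  pd s (f 2) w + (f 1 w * pd s (f 0) w - f 0 w * pd s (f 1) w) / 2.

Lemma Ck_coord i k : Ck_on k U (f i).
Proof. exact: (Ck_on_coord _ _ oU).1 (CF k) i. Qed.

Lemma Ck_pd (g : R * R -> R) s : (forall k, Ck_on k U g) -> direction s ->
  forall k, Ck_on k U (pd s g).
Proof. by move=> Cg Ds k; exact: Ck_on_derive (Cg k.+1) Ds. Qed.

Lemma Ck_lie3 s k : direction s -> Ck_on k U (lie3 s).
Proof.
move=> Ds; have C i := Ck_pd (Ck_coord i) Ds k.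
apply: (Ck_onD oU (C 2)); apply: (Ck_onM oU); last exact: Ck_on_cst.
apply: (Ck_onD oU); last apply: (Ck_onN oU).
- exact: (Ck_onM oU (Ck_coord 1 k) (C 0)).
- exact: (Ck_onM oU (Ck_coord 0 k) (C 1)).
Qed.

Lemma to_lie_derive w s : U w -> direction s ->
  to_lie (F w) ('D_s F w) = row3 (pd s (f 0) w) (pd s (f 1) w) (lie3 s w).
Proof.
move=> Uw Ds; have dF := derivable_direction (CF 1) Uw Ds.
by rewrite to_lieE !(derive_coord _ dF).
Qed.

Lemma inner_derive w s t : U w -> direction s -> direction t ->
  inner nil_metric (F w) ('D_s F w) ('D_t F w) =
  pd s (f 0) w * pd t (f 0) w + pd s (f 1) w * pd t (f 1) w + lie3 s w * lie3 t w.
Proof.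
move=> Uw Ds Dt.
exact: (inner_nil_row3 (to_lie_derive Uw Ds) (to_lie_derive Uw Dt)).
Qed.

Lemma pd_lie3 w s t : U w -> direction s -> direction t ->
  pd t (lie3 s) w = pd t (pd s (f 2)) w +
    (f 1 w * pd t (pd s (f 0)) w + pd s (f 0) w * pd t (f 1) w -
     (f 0 w * pd t (pd s (f 1)) w + pd s (f 1) w * pd t (f 0) w)) / 2.
Proof.
move=> Uw Ds Dt.
have d i := direction_derivable (Ck_coord i) Uw Dt.
have dd i := direction_derivable (Ck_pd (Ck_coord i) Ds) Uw Dt.
have p1 := derivable_prod (d 1) (dd 0).
have p2 := derivable_prod (d 0) (dd 1).
have p3 : derivable (fun z => f 1 z * pd s (f 0) z - f 0 z * pd s (f 1) z) w t.
  exact: derivableB p1 p2.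
have c2 : derivable (fun=> 2^-1 : R) w t by exact: derivable_cst.
rewrite /lie3 (pdD (dd 2) (derivable_prod p3 c2)) (pdM p3 c2) pd_cst mulr0 add0r.
by rewrite (pdB p1 p2) (pdM (d 1) (dd 0)) (pdM (d 0) (dd 1)) [2^-1 * _]mulrC.
Qed.

(** The derivatives of the frame E1, E2, E3 along F and the Christoffel terms
    combine, so that only quadratic terms independent of the point remain. *)
Lemma to_lie_nabla w s : U w -> direction s ->
  to_lie (F w) (nabla nil_metric F s s w) =
  row3 (pd s (pd s (f 0)) w + pd s (f 1) w * lie3 s w)
       (pd s (pd s (f 1)) w - pd s (f 0) w * lie3 s w)
       (pd s (lie3 s) w).
Proof.
move=> Uw Ds.
rewrite to_lieE !(nabla_coord _ _ oU Uw (CF 2) Ds) !nil_christoffel.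
cbv zeta; rewrite !row3E.
have dF := derivable_direction (CF 1) Uw Ds.
rewrite (derive_coord 0 dF) (derive_coord 1 dF) (derive_coord 2 dF).
rewrite (pd_lie3 Uw Ds Ds) /lie3 -!/(f _ _) -!/(f _).
move: (pd s (pd s (f 0)) w) (pd s (pd s (f 1)) w) (pd s (pd s (f 2)) w)
  (pd s (f 0) w) (pd s (f 1) w) (pd s (f 2) w) (f 0 w) (f 1 w) => *.
by congr row3; field.
Qed.

Lemma lie3_structure w : U w ->
  pd du (lie3 dv) w - pd dv (lie3 du) w =
  pd du (f 1) w * pd dv (f 0) w - pd du (f 0) w * pd dv (f 1) w.
Proof.
move=> Uw.
have DU : direction (@du R) by left.
have DV : direction (@dv R) by right.
rewrite (pd_lie3 Uw DV DU) (pd_lie3 Uw DU DV).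
rewrite !(mixed_partials oU Uw (Ck_coord _ 2)).
move: (pd du (pd dv (f 0)) w) (pd du (pd dv (f 1)) w) (pd du (pd dv (f 2)) w)
  (pd du (f 0) w) (pd dv (f 0) w) (pd du (f 1) w) (pd dv (f 1) w) (f 0 w) (f 1 w) => *.
by field.
Qed.

Lemma cross_lieE w : U w ->
  cross (to_lie (F w) ('D_du F w)) (to_lie (F w) ('D_dv F w)) =
  row3 (pd du (f 1) w * lie3 dv w - lie3 du w * pd dv (f 1) w)
       (lie3 du w * pd dv (f 0) w - pd du (f 0) w * lie3 dv w)
       (pd du (f 0) w * pd dv (f 1) w - pd du (f 1) w * pd dv (f 0) w).
Proof.
move=> Uw.
have DU : direction (@du R) by left.
have DV : direction (@dv R) by right.
by rewrite (to_lie_derive Uw DU) (to_lie_derive Uw DV) cross_row3.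
Qed.

End FrameOfSurface.

Section MinimalConformal.
Context {R : realType}.
Implicit Types (F : R * R -> 'rV[R]_3) (w s : R * R).

Lemma enorm_sqr (a : 'rV[R]_3) :
  (a *m a^T) 0 0 = a 0 0 * a 0 0 + a 0 1 * a 0 1 + a 0 2 * a 0 2.
Proof. by rewrite mxE sum3 !mxE. Qed.

Lemma enorm_row3 (c1 c2 c3 l : R) : 0 <= l ->
  c1 * c1 + c2 * c2 + c3 * c3 = l * l -> enorm (row3 c1 c2 c3) = l.
Proof.
by move=> l0 E; rewrite /enorm enorm_sqr !row3E E -expr2 sqrtr_sqr ger0_norm.
Qed.

Lemma second_formE F w s : second_form F s s w =
  to_lie (F w) (nabla nil_metric F s s w) 0 0 * local_normal F w 0 0 +
  to_lie (F w) (nabla nil_metric F s s w) 0 1 * local_normal F w 0 1 +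
  to_lie (F w) (nabla nil_metric F s s w) 0 2 * local_normal F w 0 2.
Proof. by rewrite /second_form inner_nil to_lieK. Qed.

Lemma dot3D (a b v : 'rV[R]_3) :
  (a + b) 0 0 * v 0 0 + (a + b) 0 1 * v 0 1 + (a + b) 0 2 * v 0 2 =
  a 0 0 * v 0 0 + a 0 1 * v 0 1 + a 0 2 * v 0 2 +
  (b 0 0 * v 0 0 + b 0 1 * v 0 1 + b 0 2 * v 0 2).
Proof. by rewrite !mxE; ring. Qed.

(** For a conformal map the trace of the second fundamental form with respect to
    the induced metric is, up to a positive factor, the trace with respect to
    du^2 + dv^2. *)
Lemma minimal_normal_tension F w :
  inner nil_metric (F w) ('D_du F w) ('D_du F w) =
    inner nil_metric (F w) ('D_dv F w) ('D_dv F w) ->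
  inner nil_metric (F w) ('D_du F w) ('D_dv F w) = 0 ->
  inner nil_metric (F w) ('D_du F w) ('D_du F w) != 0 ->
  mean_curvature F w = 0 ->
  let T := to_lie (F w) (nabla nil_metric F du du w) +
           to_lie (F w) (nabla nil_metric F dv dv w) in
  let N := local_normal F w in
  T 0 0 * N 0 0 + T 0 1 * N 0 1 + T 0 2 * N 0 2 = 0.
Proof.
pose I s t := inner nil_metric (F w) ('D_s F w) ('D_t F w).
rewrite -/(I du du) -/(I dv dv) -/(I du dv) => IE I0 In0 H T N.
have H' : (I du du * second_form F dv dv w - 2 * I du dv * second_form F du dv w
    + I dv dv * second_form F du du w) /
  (2 * (I du du * I dv dv - I du dv ^+ 2)) = 0 by exact: H.
rewrite -IE I0 in H'.
have AB := conformal_mean_curvature In0 H'.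
rewrite !second_formE in AB.
by rewrite -AB; exact: dot3D.
Qed.

Lemma row3D (p1 p2 p3 q1 q2 q3 : R) :
  row3 p1 p2 p3 + row3 q1 q2 q3 = row3 (p1 + q1) (p2 + q2) (p3 + q3).
Proof. by apply/rowP; apply: ord3_ind; rewrite mxE !row3E. Qed.

Lemma row3Z (e p1 p2 p3 : R) :
  e *: row3 p1 p2 p3 = row3 (e * p1) (e * p2) (e * p3).
Proof. by apply/rowP; apply: ord3_ind; rewrite mxE !row3E. Qed.

Lemma dot3_rows (a b v : 'rV[R]_3) (p1 p2 p3 q1 q2 q3 c1 c2 c3 : R) :
  a = row3 p1 p2 p3 -> b = row3 q1 q2 q3 -> v = row3 c1 c2 c3 ->
  (a + b) 0 0 * v 0 0 + (a + b) 0 1 * v 0 1 + (a + b) 0 2 * v 0 2 =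
  (p1 + q1) * c1 + (p2 + q2) * c2 + (p3 + q3) * c3.
Proof. by move=> -> -> ->; rewrite row3D !row3E. Qed.

Lemma normal_component (e c1 c2 c3 x y z x' y' z' p p' q q' : R) : e != 0 ->
  (x + p + (x' + p')) * (e * c1) + (y - q + (y' - q')) * (e * c2) +
    (z + z') * (e * c3) = 0 ->
  (x + x' + (p + p')) * c1 + (y + y' - (q + q')) * c2 + (z + z') * c3 = 0.
Proof.
by move=> e0 E; apply: (mulfI e0); rewrite mulr0 -E; ring.
Qed.

Lemma stereographic_normal (g1 g2 k : R) : 0 < k ->
  let W := 1 - (g1 * g1 + g2 * g2) in
  let N := normalize (row3 (2 * g1 * k) (2 * g2 * k) (W * k)) in
  N 0 0 / (1 + N 0 2) = g1 /\ N 0 1 / (1 + N 0 2) = g2.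
Proof.
move=> k0 W N.
have r0 : 0 <= g1 * g1 + g2 * g2 by rewrite addr_ge0// -expr2 sqr_ge0.
have l0 : 0 < (1 + (g1 * g1 + g2 * g2)) * k by rewrite mulr_gt0// ltr_wpDr.
have eE : enorm (row3 (2 * g1 * k) (2 * g2 * k) (W * k)) = (1 + (g1 * g1 + g2 * g2)) * k.
  by apply: enorm_row3; [exact: ltW|rewrite /W; ring].
rewrite /N /normalize eE row3Z row3_0 row3_1 row3_2 /W.
move: (lt0r_neq0 l0) (lt0r_neq0 k0); rewrite mulf_eq0 negb_or => /andP[r1 _] kn0.
have s0 : 1 + ((1 + (g1 * g1 + g2 * g2)) * k)^-1 * ((1 - (g1 * g1 + g2 * g2)) * k)
    = 2 / (1 + (g1 * g1 + g2 * g2)) by field; rewrite kn0 r1.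
by rewrite s0; split; field; rewrite kn0 r1.
Qed.

End MinimalConformal.

(** * Harmonic maps into the Poincare disk *)

Section HyperbolicMetric.
Context {R : realType}.
Implicit Types (x a v : 'rV[R]_2).

Lemma ord2_ind (P : 'I_2 -> Prop) : P 0 -> P 1 -> forall i, P i.
Proof.
move=> P0 P1 [[|[|//]] Hi].
- by rewrite (_ : Ordinal Hi = 0)//; apply/val_inj.
- by rewrite (_ : Ordinal Hi = 1)//; apply/val_inj.
Qed.

Lemma sum2 (V : nmodType) (f : 'I_2 -> V) : \sum_i f i = f 0 + f 1.
Proof.
rewrite !big_ord_recl big_ord0 addr0.
by congr (_ + _); congr f; apply/val_inj.
Qed.

Definition disk_gap x : R := 1 - (x 0 0 ^+ 2 + x 0 1 ^+ 2).

Lemma derive_conformal_factor x v : disk_gap x != 0 ->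
  'D_v (fun y => 4 / disk_gap y ^+ 2) x =
  16 * (x 0 0 * v 0 0 + x 0 1 * v 0 1) / disk_gap x ^+ 3.
Proof.
move=> W0.
have h0 := is_derive_coord x v 0; have h1 := is_derive_coord x v 1.
have hs := is_deriveD (is_deriveX 2 h0) (is_deriveX 2 h1).
have hW : is_derive x v disk_gap _ := is_deriveB (is_derive_cst (1 : R) x v) hs.
have hW2 : is_derive x v (fun y => disk_gap y ^+ 2) _ := is_deriveX 2 hW.
have W20 : disk_gap x ^+ 2 != 0 by rewrite expf_neq0.
have dV := @derivableV _ _ _ x v W20 (@ex_derive _ _ _ _ _ _ _ hW2).
have eV := @deriveV _ _ _ x v W20 (@ex_derive _ _ _ _ _ _ _ hW2).
have hV := DeriveDef dV eV.
have [_ E] := is_deriveM (is_derive_cst (4 : R) x v) hV.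
rewrite (_ : (fun y => _) = cst 4 * (fun y => (disk_gap y ^+ 2)^-1))//.
rewrite [LHS]E (@derive_val _ _ _ _ _ _ _ hW2) /=.
rewrite /GRing.scale /=.
move: W0; set W := disk_gap x => W0.
by field.
Qed.

(** The metric is conformal to the Euclidean one, so its Christoffel symbols only
    involve half of the logarithmic derivative of the factor, with components
    2 x_i / (1 - |x|^2). *)
Lemma hyperbolic_christoffel x a (k : 'I_2) : disk_gap x != 0 ->
  \sum_(i < 2) \sum_(j < 2) christoffel hyperbolic_metric x k i j * a 0 i * a 0 j =
  2 / disk_gap x * (2 * a 0 k * (x 0 0 * a 0 0 + x 0 1 * a 0 1) -
    x 0 k * (a 0 0 * a 0 0 + a 0 1 * a 0 1)).
Proof.
move=> W0.
have dE (l p q : 'I_2) : 'D_(delta_mx 0 l) (fun y => hyperbolic_metric y p q) x =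
    16 * x 0 l / disk_gap x ^+ 3 * (p == q)%:R.
  have -> : (fun y : 'rV[R]_2 => hyperbolic_metric y p q) =
     (fun y => (4 / disk_gap y ^+ 2) *+ (p == q)).
    by apply: funext => y; rewrite mxE.
  case: (p == q); last by rewrite mulr0n mulr0; exact: derive_cst.
  rewrite mulr1 (derive_conformal_factor _ W0); congr (_ * _ / _).
  by move: l; apply: ord2_ind; rewrite !mxE /= ?mulr0 ?mulr1 ?addr0 ?add0r.
have cE (i j : 'I_2) : christoffel hyperbolic_metric x k i j =
   2 / disk_gap x * (x 0 i * (j == k)%:R + x 0 j * (i == k)%:R - x 0 k * (i == j)%:R).
  rewrite /christoffel invmx_scalar.
  have -> : \sum_(l < 2) ((4 / disk_gap x ^+ 2)^-1)%:M k l *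
     ('D_(delta_mx 0 i) (fun y => hyperbolic_metric y j l) x +
      'D_(delta_mx 0 j) (fun y => hyperbolic_metric y i l) x -
      'D_(delta_mx 0 l) (fun y => hyperbolic_metric y i j) x) =
     (4 / disk_gap x ^+ 2)^-1 * (16 * x 0 i / disk_gap x ^+ 3 * (j == k)%:R +
       16 * x 0 j / disk_gap x ^+ 3 * (i == k)%:R -
       16 * x 0 k / disk_gap x ^+ 3 * (i == j)%:R).
    rewrite (bigD1 k)//= big1 ?addr0; first by rewrite mxE eqxx mulr1n !dE.
    by move=> l lk; rewrite mxE eq_sym (negPf lk) mulr0n mul0r.
  move: W0; move: (disk_gap x) (x 0 i) (x 0 j) (x 0 k) => W xi xj xk W0.
  by move: ((j == k)%:R : R) ((i == k)%:R : R) ((i == j)%:R : R) => *; field.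
rewrite !sum2 !cE; move: k cE; apply: ord2_ind => cE /=; clear cE dE;
  move: (x 0 0) (x 0 1) (a 0 0) (a 0 1) => *; by field.
Qed.

End HyperbolicMetric.

(** In one chart: the functions a, b of the surface satisfy all the hypotheses
    required of a conformal frame. *)
Lemma gauss_map_local (R : realType) (U : set (R * R)) (F : R * R -> 'rV[R]_3) :
  open U -> (forall k, Ck_on k U F) ->
  (forall w, U w ->
    inner nil_metric (F w) ('D_du F w) ('D_du F w) =
      inner nil_metric (F w) ('D_dv F w) ('D_dv F w) /\
    inner nil_metric (F w) ('D_du F w) ('D_dv F w) = 0) ->
  (forall w, U w -> mean_curvature F w = 0) ->
  (forall w, U w -> 0 < local_normal F w 0 2) ->
  exists G1 G2 : R * R -> R,
    [/\ forall k, Ck_on k U G1, forall k, Ck_on k U G2,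
      forall w, U w -> [/\ local_normal F w 0 0 / (1 + local_normal F w 0 2) = G1 w,
        local_normal F w 0 1 / (1 + local_normal F w 0 2) = G2 w &
        0 < 1 - (G1 w * G1 w + G2 w * G2 w)] &
      forall w, U w -> disk_tension G1 G2 w = 0 /\ disk_tension G2 G1 w = 0].
Proof.
move=> oU CF conf minF upF.
have DU : direction (@du R) by left.
have DV : direction (@dv R) by right.
pose f i w : R := F w 0 i.
pose a1 := pd du (f 0); pose a2 := pd du (f 1); pose a3 := lie3 F du.
pose b1 := pd dv (f 0); pose b2 := pd dv (f 1); pose b3 := lie3 F dv.
have Ca1 := Ck_pd (Ck_coord oU CF 0) DU; have Ca2 := Ck_pd (Ck_coord oU CF 1) DU.
have Cb1 := Ck_pd (Ck_coord oU CF 0) DV; have Cb2 := Ck_pd (Ck_coord oU CF 1) DV.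
have Ca3 k := Ck_lie3 oU CF k DU; have Cb3 k := Ck_lie3 oU CF k DV.
have mc1 w : U w -> pd du b1 w = pd dv a1 w.
  by move=> Uw; apply/esym/(mixed_partials oU Uw (Ck_coord oU CF 0 2)).
have mc2 w : U w -> pd du b2 w = pd dv a2 w.
  by move=> Uw; apply/esym/(mixed_partials oU Uw (Ck_coord oU CF 1 2)).
have mc3 w : U w -> pd du b3 w - pd dv a3 w = a2 w * b1 w - a1 w * b2 w.
  by move=> Uw; exact: (lie3_structure oU CF Uw).
have cf1 w : U w -> a1 w * a1 w + a2 w * a2 w + a3 w * a3 w =
    b1 w * b1 w + b2 w * b2 w + b3 w * b3 w.
  move=> Uw; have [E _] := conf w Uw.
  exact: etrans (esym (inner_derive CF Uw DU DU)) (etrans E (inner_derive CF Uw DV DV)).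
have cf2 w : U w -> a1 w * b1 w + a2 w * b2 w + a3 w * b3 w = 0.
  move=> Uw; have [_ E] := conf w Uw.
  exact: etrans (esym (inner_derive CF Uw DU DV)) E.
have NE w : U w -> local_normal F w = normalize (row3 (a2 w * b3 w - a3 w * b2 w)
    (a3 w * b1 w - a1 w * b3 w) (a1 w * b2 w - a2 w * b1 w)).
  by move=> Uw; rewrite /local_normal (cross_lieE CF Uw).
have up w : U w -> 0 < a1 w * b2 w - a2 w * b1 w.
  move=> Uw; have := upF w Uw; rewrite (NE w Uw) /normalize mxE row3_2.
  move=> H; rewrite ltNge; apply/negP => c0; move: H.
  by rewrite ltNge mulr_ge0_le0// invr_ge0 sqrtr_ge0.
have lam w : U w -> inner nil_metric (F w) ('D_du F w) ('D_du F w) =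
    a1 w * a1 w + a2 w * a2 w + a3 w * a3 w.
  by move=> Uw; exact: (inner_derive CF Uw DU DU).
have kpos w : U w -> 0 < (frameP a1 b2 w * frameP a1 b2 w + frameQ a2 b1 w * frameQ a2 b1 w) *
   (1 + (gaussG1 a1 a2 a3 b1 b2 b3 w * gaussG1 a1 a2 a3 b1 b2 b3 w +
         gaussG2 a1 a2 a3 b1 b2 b3 w * gaussG2 a1 a2 a3 b1 b2 b3 w)) / 4.
  move=> Uw; rewrite divr_gt0// mulr_gt0//; first exact: gauss_den_gt0 (up w Uw).
  by rewrite ltr_wpDr// addr_ge0// -expr2 sqr_ge0.
have Nfr w (Uw : U w) := frame_normal cf1 cf2 up Uw.
(* the induced metric is nondegenerate, as minimality divides by it *)
have lam0 w : U w -> inner nil_metric (F w) ('D_du F w) ('D_du F w) != 0.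
  move=> Uw; rewrite (lam w Uw); have [_ _ _ ->] := Nfr w Uw.
  rewrite mulf_neq0//; last exact: lt0r_neq0 (kpos w Uw).
  by rewrite lt0r_neq0// ltr_wpDr// addr_ge0// -expr2 sqr_ge0.
have min w : U w ->
  (pd du a1 w + pd dv b1 w + (a2 w * a3 w + b2 w * b3 w)) *
    (a2 w * b3 w - a3 w * b2 w) +
  (pd du a2 w + pd dv b2 w - (a1 w * a3 w + b1 w * b3 w)) *
    (a3 w * b1 w - a1 w * b3 w) +
  (pd du a3 w + pd dv b3 w) * (a1 w * b2 w - a2 w * b1 w) = 0.
  move=> Uw; have [IE I0] := conf w Uw.
  have Z := minimal_normal_tension IE I0 (lam0 w Uw) (minF w Uw).
  have := upF w Uw; have := NE w Uw; rewrite /normalize row3Z.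
  set e := (enorm _)^-1 => Ne eN.
  have e0 : e != 0.
    by apply: contraTneq eN => e0; rewrite Ne row3_2 e0 mul0r ltxx.
  have E := dot3_rows (to_lie_nabla oU CF Uw DU) (to_lie_nabla oU CF Uw DV) Ne.
  exact: (normal_component e0 (etrans (esym E) Z)).
exists (gaussG1 a1 a2 a3 b1 b2 b3), (gaussG2 a1 a2 a3 b1 b2 b3); split.
- exact: (Ck_gaussG1 oU Ca1 Ca2 Ca3 Cb1 Cb2 Cb3 up).
- exact: (Ck_gaussG2 oU Ca1 Ca2 Ca3 Cb1 Cb2 Cb3 up).
- move=> w Uw; have W0 := disk_room_gt0 cf1 cf2 up Uw.
  have [E1 E2 E3 _] := Nfr w Uw.
  rewrite (NE w Uw) E1 E2 E3.
  have [S1 S2] := stereographic_normal (gaussG1 a1 a2 a3 b1 b2 b3 w)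
     (gaussG2 a1 a2 a3 b1 b2 b3 w) (kpos w Uw).
  by split; [exact: S1|exact: S2|exact: W0].
- move=> w Uw.
  exact: (gauss_harmonic oU Ca1 Ca2 Ca3 Cb1 Cb2 Cb3 mc1 mc2 mc3 cf1 cf2 up min Uw).
Qed.

Lemma row_add_eq0 (R : realType) n (a b : 'rV[R]_n) k (x y : R) :
  a 0 k = x -> b 0 k = y -> x + y = 0 -> (a + b) 0 k = (0 : 'rV[R]_n) 0 k.
Proof. by move=> ax bx xy; rewrite !mxE ax bx. Qed.

Lemma hyperbolic_tension (R : realType) (U : set (R * R))
    (H : R * R -> 'rV[R]_2) (G1 G2 : R * R -> R) w :
  open U -> U w -> (forall k, Ck_on k U G1) -> (forall k, Ck_on k U G2) ->
  (forall z, U z -> H z 0 0 = G1 z) -> (forall z, U z -> H z 0 1 = G2 z) ->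
  0 < 1 - (G1 w * G1 w + G2 w * G2 w) ->
  disk_tension G1 G2 w = 0 -> disk_tension G2 G1 w = 0 ->
  (forall k, Ck_on k U H) /\ tension hyperbolic_metric H w = 0.
Proof.
move=> oU Uw C1 C2 H1 H2 W0 T1 T2.
have CH k : Ck_on k U H.
  apply: (Ck_on_coord k H oU).2; apply: ord2_ind.
  - by apply: (Ck_on_eq oU _ (C1 k)) => z Uz; rewrite H1.
  - by apply: (Ck_on_eq oU _ (C2 k)) => z Uz; rewrite H2.
split => //.
have DU : direction (@du R) by left.
have DV : direction (@dv R) by right.
have p1 s z : U z -> pd s (fun z => H z 0 0) z = pd s G1 z.
  by move=> Uz; exact: (pd_eq s oU Uz H1).
have p2 s z : U z -> pd s (fun z => H z 0 1) z = pd s G2 z.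
  by move=> Uz; exact: (pd_eq s oU Uz H2).
have D s : direction s -> 'D_s H w 0 0 = pd s G1 w /\ 'D_s H w 0 1 = pd s G2 w.
  move=> Ds; have dH := derivable_direction (CH 1) Uw Ds.
  by rewrite (derive_coord 0 dH) (derive_coord 1 dH) p1// p2.
have gapE : disk_gap (H w) = 1 - (G1 w * G1 w + G2 w * G2 w).
  by rewrite /disk_gap H1// H2// !expr2.
have gap0 : disk_gap (H w) != 0 by rewrite gapE lt0r_neq0.
have n1 s : direction s -> nabla hyperbolic_metric H s s w 0 0 =
    disk_second_derivative G1 G2 s w.
  move=> Ds; have [D1 D2] := D s Ds.
  rewrite (nabla_coord _ 0 oU Uw (CH 2) Ds) (hyperbolic_christoffel _ _ gap0).
  by rewrite D1 D2 gapE (H1 w Uw) (H2 w Uw) (pd_eq s oU Uw (p1 s)).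
have n2 s : direction s -> nabla hyperbolic_metric H s s w 0 1 =
    disk_second_derivative G2 G1 s w.
  move=> Ds; have [D1 D2] := D s Ds.
  rewrite (nabla_coord _ 1 oU Uw (CH 2) Ds) (hyperbolic_christoffel _ _ gap0).
  rewrite D1 D2 gapE (H1 w Uw) (H2 w Uw) (pd_eq s oU Uw (p2 s)).
  rewrite /disk_second_derivative (addrC (G2 w * G2 w)).
  by rewrite (addrC (G2 w * pd s G2 w)) (addrC (pd s G2 w * _)).
apply/rowP; apply: ord2_ind.
- exact: (row_add_eq0 (n1 _ DU) (n1 _ DV) T1).
- exact: (row_add_eq0 (n2 _ DU) (n2 _ DV) T2).
Qed.

Theorem corollary3p7 (R : realType) (S : riemannSurface R)
    (X : S -> 'rV[R]_3) :
  immersion X -> conformal X -> minimal X -> nowhere_vertical X -> upward X ->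
  exists g : S -> Cplx R,
    [/\ forall p, gauss_map X p = Some (g p),
        forall p, poincare_disk (g p) &
        harmonic_map hyperbolic_metric (fun p => plane_coord (g p))].
Proof.
move=> iX cX mX _ uX.
pose N := unit_normal X.
pose g p : Cplx R := ((N p 0 0 / (1 + N p 0 2)) +i* (N p 0 1 / (1 + N p 0 2)))%C.
have Nc c w (ac : @atlas R S c) (cw : local_dom c w) :
    N (cinv c (plane_to_C w)) = local_normal (local_rep c X) w.
  exact: unit_normal_chart.
have loc c (ac : @atlas R S c) :=
  gauss_map_local (@open_local_dom _ _ c) (iX.1 c ac) (cX c ac) (mX c ac).
have {}loc c (ac : @atlas R S c) : exists G1 G2 : R * R -> R,
    [/\ forall k, Ck_on k (local_dom c) G1, forall k, Ck_on k (local_dom c) G2,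
      forall w, local_dom c w -> [/\ complex.Re (g (cinv c (plane_to_C w))) = G1 w,
        complex.Im (g (cinv c (plane_to_C w))) = G2 w &
        0 < 1 - (G1 w * G1 w + G2 w * G2 w)] &
      forall w, local_dom c w -> disk_tension G1 G2 w = 0 /\ disk_tension G2 G1 w = 0].
  have [|G1 [G2 [C1 C2 NG TG]]] := loc c ac.
    by move=> w cw; rewrite -(Nc c w ac cw); exact: uX.
  exists G1, G2; split => // w cw; rewrite /g /= (Nc c w ac cw); exact: NG.
exists g; split.
- move=> p; rewrite /gauss_map /stereographic -/(N p).
  by rewrite gt_eqF// ltr_wpDr// ltW// uX.
- move=> p.
  have [G1 [G2 [_ _ NG _]]] := loc _ (chart_at_atlas p).
  have cp := cmap_img (chart_at_dom p).
  have toK z : plane_to_C (C_to_plane z) = z :> Cplx R by case: z.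
  have := NG (C_to_plane (cmap (chart_at p) p)).
  rewrite toK cmapK; last exact: chart_at_dom.
  have dom : local_dom (chart_at p) (C_to_plane (cmap (chart_at p) p)).
    by rewrite /local_dom /=; case: (cmap _ _) cp.
  move=> /(_ dom)[E1 E2 G0].
  rewrite /poincare_disk /= -[1]/((1 : R)%:C%C) modulus_lt /modulus E1 E2.
  rewrite -[ltRHS]sqrtr1 ltr_sqrt// !expr2; move: G0; rewrite subr_gt0; exact.
- split=> c ac.
    move=> k; have [G1 [G2 [C1 C2 NG TG]]] := loc c ac.
    apply: (Ck_on_coord k _ (@open_local_dom _ _ c)).2; apply: ord2_ind.
    + apply: (Ck_on_eq (@open_local_dom _ _ c) _ (C1 k)) => w cw.
      by have [E _ _] := NG w cw; rewrite /local_rep /plane_coord mxE /= -E.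
    + apply: (Ck_on_eq (@open_local_dom _ _ c) _ (C2 k)) => w cw.
      by have [_ E _] := NG w cw; rewrite /local_rep /plane_coord mxE /= -E.
  move=> w cw; have [G1 [G2 [C1 C2 NG TG]]] := loc c ac.
  have [T1 T2] := TG w cw; have [_ _ W0] := NG w cw.
  have [] := hyperbolic_tension (H := local_rep c (fun p => plane_coord (g p)))
    (@open_local_dom _ _ c) cw C1 C2 _ _ W0 T1 T2 => //.
  + by move=> z cz; have [E _ _] := NG z cz; rewrite /local_rep /plane_coord mxE /= -E.
  + by move=> z cz; have [_ E _] := NG z cz; rewrite /local_rep /plane_coord mxE /= -E.
Qed.
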